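(* For every $(K_1,K_2)$ discrete memoryless MAC-IC-MAC with capacity region $\mathcal{C}$ and every distribution $P_{\mathrm{in}}\in\mathcal{P}_{\mathrm{in}}$, $$\mathcal{R}_{\mathrm{in}}(P_{\mathrm{in}})\subseteq\mathcal{C}.$$
   Context: **Indices.** $K_1,K_2\ge 1$ are integers. For $i\in\{1,2\}$, $i'$ denotes the other element of $\{1,2\}$, and $\varTheta_i=\{i.1,\dots,i.K_i\}$ is the set of labels of the users of cell $i$. $\varUpsilon_i$ always denotes a subset of $\varTheta_i$ containing $i.1$; $\varOmega_i$ always denotes a non-empty subset of $\varTheta_i$; $\bar{\varUpsilon}_i,\bar{\varOmega}_i$ are complements in $\varTheta_i$. For $S\subseteq\varTheta_i$, $X_S=(X_{i.j})_{i.j\in S}$, and for a rate tuple write $R(S)=\sum_{i.j\in S}R_{i.j}$. **Channel.** A $(K_1,K_2)$ discrete memoryless (DM) MAC-IC-MAC has $K_1+K_2$ transmitters Tx$i.j$ with discrete input alphabets $\mathcal{X}_{i.j}$, two receivers Rx$i$ with discrete output alphabets $\mathcal{Y}_i$, and transition law $$p(y_1^n,y_2^n|x_{\varTheta_1}^n,x_{\varTheta_2}^n)=\prod_{t=1}^n p(y_{1t}|x_{\varTheta_1 t},x_{2.1t})\,p(y_{2t}|x_{\varTheta_2 t},x_{1.1t}).$$ Tx$i.j$ encodes a message $M_{i.j}$, uniform on $\{1,\dots,2^{nR_{i.j}}\}$ (messages independent), into $x_{i.j}^n(M_{i.j})$; Rx$i$ produces an estimate $\hat M_{\varTheta_i}$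 of $M_{\varTheta_i}$ from $Y_i^n$. The error probability is $P_e^{(n)}=P\{\hat M_{\varTheta_1}\ne M_{\varTheta_1}\text{ or }\hat M_{\varTheta_2}\neq M_{\varTheta_2}\}$. A tuple $(R_{\varTheta_1},R_{\varTheta_2})\in\mathbb{R}_+^{K_1+K_2}$ is achievable if there are codes of these rates with $P_e^{(n)}\to0$ as $n\to\infty$; the capacity region $\mathcal{C}$ is the closure of the set of achievable tuples. **Coding distributions.** $\mathcal{P}_{\mathrm{in}}$ is the set of joint distributions of discrete random variables $(Q,U_1,X_{\varTheta_1},U_2,X_{\varTheta_2})$ that factor as $$p(q)\,p(u_1,x_{1.1}|q)\prod_{j=2}^{K_1}p(x_{1.j}|q)\;p(u_2,x_{2.1}|q)\prod_{j=2}^{K_2}p(x_{2.j}|q).$$ The outputs $(Y_1,Y_2)$ are generated from $(X_{\varTheta_1},X_{\varTheta_2})$ by the channel (independently of $Q,U_1,U_2$ given the inputs). **Set functions.** Given $P_{\mathrm{in}}$, $$\mathsf{A}_{\varUpsilon_i}=I(X_{\varUpsilon_i};Y_i|X_{\bar\varUpsilon_i},U_i,U_{i'},Q),\qquad \mathsf{B}_{\varOmega_i}=I(X_{\varOmega_i};Y_i|X_{\bar\varOmega_i},U_{i'},Q),$$ $$\mathsf{E}_{\varUpsilon_i}=I(X_{\varUpsilon_i},U_{i'};Y_i|X_{\bar\varUpsilon_i},U_i,Q),\qquad \mathsf{G}_{\varOmega_i}=I(X_{\varOmega_i},U_{i'};Y_i|X_{\bar\varOmega_i},Q).$$ **Region.**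 $\mathcal{R}_{\mathrm{in}}(P_{\mathrm{in}})$ is the set of $(R_{\varTheta_1},R_{\varTheta_2})\in\mathbb{R}_+^{K_1+K_2}$ such that for all admissible $\varUpsilon_1,\varOmega_1,\varUpsilon_2,\varOmega_2$: 1. $R(\varOmega_1)\le\mathsf{B}_{\varOmega_1}$ 2. $R(\varUpsilon_1)\le\mathsf{A}_{\varUpsilon_1}+\mathsf{E}_{\varUpsilon_2}$ 3. $R(\varOmega_2)\le\mathsf{B}_{\varOmega_2}$ 4. $R(\varUpsilon_2)\le\mathsf{E}_{\varUpsilon_1}+\mathsf{A}_{\varUpsilon_2}$ 5. $R(\varUpsilon_1)+R(\varOmega_2)\le\mathsf{A}_{\varUpsilon_1}+\mathsf{G}_{\varOmega_2}$ 6. $R(\varOmega_1)+R(\varUpsilon_2)\le\mathsf{G}_{\varOmega_1}+\mathsf{A}_{\varUpsilon_2}$ 7. $R(\varUpsilon_1)+R(\varUpsilon_2)\le\mathsf{E}_{\varUpsilon_1}+\mathsf{E}_{\varUpsilon_2}$ 8. $R(\varUpsilon_1)+R(\varOmega_1)+R(\varUpsilon_2)\le\mathsf{A}_{\varUpsilon_1}+\mathsf{G}_{\varOmega_1}+\mathsf{E}_{\varUpsilon_2}$ 9. $R(\varUpsilon_1)+R(\varUpsilon_2)+R(\varOmega_2)\le\mathsf{E}_{\varUpsilon_1}+\mathsf{A}_{\varUpsilon_2}+\mathsf{G}_{\varOmega_2}$. *)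

(* Defs.v *)
From HB Require Import structures.
From mathcomp Require Import all_boot all_order all_algebra.
From mathcomp Require Import all_classical all_reals all_analysis.

Set Implicit Arguments.
Unset Strict Implicit.
Unset Printing Implicit Defensive.

Import Order.TTheory GRing.Theory Num.Theory.
Import numFieldNormedType.Exports.

Local Open Scope classical_set_scope.
Local Open Scope ring_scope.

(* All alphabets are finite: "discrete" has its usual meaning for discrete
   memoryless channels. *)

(** * Finite probability and information measures *)

Definition is_dist (R : realType) (T : finType) (p : T -> R) : Prop :=
  (forall t, 0 <= p t) /\ \sum_t p t = 1.

Definition log2 (R : realType) (x : R) : R := ln x / ln 2.

Definition pr (R : realType) (T A : finType) (p : T -> R) (f : T -> A) (a : A) : R :=
  \sum_(t | f t == a) p t.

(* I(f; g | h) in bits, for random variables f, g, h on the finite probability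
   space (T, p).  A triple with pr p (f, g, h) = 0 contributes 0, and otherwise
   neither denominator vanishes. *)
Definition cond_mutual_info (R : realType) (T A B C : finType) (p : T -> R)
    (f : T -> A) (g : T -> B) (h : T -> C) : R :=
  \sum_a \sum_b \sum_c
    pr p (fun t => (f t, g t, h t)) (a, b, c) *
    log2 (pr p (fun t => (f t, g t, h t)) (a, b, c) * pr p h c /
          (pr p (fun t => (f t, h t)) (a, c) * pr p (fun t => (g t, h t)) (b, c))).

(** * The channel *)

(* The two cells are the booleans: [false] is cell 1, [true] is cell 2, and
   [~~ i] is the other cell i'.  Cell [i] has K_i = (k i).+1 >= 1 users, user
   i.1 being [ord0]. *)
Notation cell := bool.
Notation cell1 := false (only parsing).
Notation cell2 := true (only parsing).

Definition user (k : cell -> nat) (i : cell) : finType := 'I_(k i).+1.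

Definition user1 (k : cell -> nat) (i : cell) : user k i := ord0.

(* [ch_law i x x' y] is p(y_i | x_{Theta_i}, x_{i'.1}) *)
Record mac_ic_mac (R : realType) (k : cell -> nat) := MacIcMac {
  ch_in : forall i : cell, user k i -> finType;
  ch_out : cell -> finType;
  ch_law : forall i : cell, {dffun forall j : user k i, ch_in j} ->
             ch_in (user1 k (~~ i)) -> ch_out i -> R;
  ch_law_dist : forall (i : cell) (x : {dffun forall j : user k i, ch_in j})
             (x' : ch_in (user1 k (~~ i))), is_dist (ch_law x x') }.

Definition cell_input (R : realType) (k : cell -> nat) (C : mac_ic_mac R k)
    (i : cell) : finType := {dffun forall j : user k i, ch_in C j}.

Definition inputs (R : realType) (k : cell -> nat) (C : mac_ic_mac R k) : finType :=
  {dffun forall i : cell, cell_input C i}.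

Definition outputs (R : realType) (k : cell -> nat) (C : mac_ic_mac R k) : finType :=
  {dffun forall i : cell, ch_out C i}.

Definition channel_law (R : realType) (k : cell -> nat) (C : mac_ic_mac R k)
    (x : inputs C) (y : outputs C) : R :=
  \prod_(i : cell) ch_law (x i) (x (~~ i) (user1 k (~~ i))) (y i).

(** * Codes and capacity region *)

(* [M i j] is the number of messages of user i.j. *)
Definition cell_message (k : cell -> nat) (M : forall i : cell, user k i -> nat)
    (i : cell) : finType := {dffun forall j : user k i, 'I_(M i j)}.

Definition messages (k : cell -> nat) (M : forall i : cell, user k i -> nat) : finType :=
  {dffun forall i : cell, cell_message M i}.

Record code (R : realType) (k : cell -> nat) (C : mac_ic_mac R k) (n : nat)
    (M : forall i : cell, user k i -> nat) := Code {
  enc : forall (i : cell) (j : user k i), 'I_(M i j) -> {ffun 'I_n -> ch_in C j};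
  dec : forall i : cell, {ffun 'I_n -> ch_out C i} -> cell_message M i }.

Definition codeword (R : realType) (k : cell -> nat) (C : mac_ic_mac R k) (n : nat)
    (M : forall i : cell, user k i -> nat) (c : code C n M) (m : messages M)
    (t : 'I_n) : inputs C :=
  [ffun i : cell => [ffun j : user k i => enc c (m i j) t] : cell_input C i].

Definition error_prob (R : realType) (k : cell -> nat) (C : mac_ic_mac R k) (n : nat)
    (M : forall i : cell, user k i -> nat) (c : code C n M) : R :=
  #|messages M|%:R^-1 *
  \sum_(m : messages M)
    \sum_(y : {ffun 'I_n -> outputs C} |
          [exists i : cell, dec c [ffun t => y t i] != m i])
      \prod_(t < n) channel_law (codeword c m t) (y t).

Definition rates (R : realType) (k : cell -> nat) : Type :=
  ('rV[R]_(k cell1).+1 * 'rV[R]_(k cell2).+1)%type.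

Definition rate (R : realType) (k : cell -> nat) (r : rates R k) (i : cell) :
    user k i -> R :=
  match i with
  | cell1 => fun j => r.1 ord0 j
  | cell2 => fun j => r.2 ord0 j
  end.

Definition nonneg_rates (R : realType) (k : cell -> nat) (r : rates R k) : Prop :=
  forall (i : cell) (j : user k i), 0 <= rate r j.

(* 2^{nR} need not be an integer; rounding it up makes the actual rate of every
   user at least the nominal one. *)
Definition num_messages (R : realType) (k : cell -> nat) (r : rates R k) (n : nat)
    (i : cell) (j : user k i) : nat :=
  `|Num.ceil (2 `^ (n%:R * rate r j) : R)|%N.

Definition achievable (R : realType) (k : cell -> nat) (C : mac_ic_mac R k)
    (r : rates R k) : Prop :=
  nonneg_rates r /\
  exists c : forall n : nat, code C n (num_messages r n),
    (fun n => error_prob (c n)) @ \oo --> (0 : R).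

Definition capacity_region (R : realType) (k : cell -> nat) (C : mac_ic_mac R k) :
    set (rates R k) :=
  closure [set r : rates R k | achievable C r].

(** * Coding distributions *)

Definition aux (U : cell -> finType) : finType := {dffun forall i : cell, U i}.

(* Values of (Q, (U_1, U_2), (X_{Theta_1}, X_{Theta_2})). *)
Definition coding (R : realType) (k : cell -> nat) (C : mac_ic_mac R k)
    (Q : finType) (U : cell -> finType) : finType := (Q * aux U * inputs C)%type.

Definition coding_dist (R : realType) (k : cell -> nat) (C : mac_ic_mac R k)
    (Q : finType) (U : cell -> finType) (P : coding C Q U -> R) : Prop :=
  exists (pQ : Q -> R)
         (pUX : forall i : cell, Q -> U i * ch_in C (user1 k i) -> R)
         (pX : forall (i : cell) (j : user k i), Q -> ch_in C j -> R),
    [/\ is_dist pQ,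
        forall (i : cell) (q : Q), is_dist (pUX i q),
        forall (i : cell) (j : user k i) (q : Q), j != user1 k i -> is_dist (pX i j q) &
        forall (q : Q) (u : aux U) (x : inputs C),
          P (q, u, x) =
          pQ q * \prod_(i : cell)
                   (pUX i q (u i, x i (user1 k i)) *
                    \prod_(j : user k i | j != user1 k i) pX i j q (x i j)) ].

(** * The rate region *)

(* The sets S range over subsets of Theta_i: [infoA] and [infoE] are used for S
   containing i.1 (V1, V2 below), [infoB] and [infoG] for S nonempty (W1, W2). *)

Definition outcome (R : realType) (k : cell -> nat) (C : mac_ic_mac R k)
    (Q : finType) (U : cell -> finType) : finType := (coding C Q U * outputs C)%type.

Definition joint_dist (R : realType) (k : cell -> nat) (C : mac_ic_mac R k)
    (Q : finType) (U : cell -> finType) (P : coding C Q U -> R)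
    (w : outcome C Q U) : R := P w.1 * channel_law w.1.2 w.2.

Definition rvQ (R : realType) (k : cell -> nat) (C : mac_ic_mac R k)
    (Q : finType) (U : cell -> finType) (w : outcome C Q U) : Q := w.1.1.1.

Definition rvU (R : realType) (k : cell -> nat) (C : mac_ic_mac R k)
    (Q : finType) (U : cell -> finType) (i : cell) (w : outcome C Q U) : U i :=
  w.1.1.2 i.

Definition rvX (R : realType) (k : cell -> nat) (C : mac_ic_mac R k)
    (Q : finType) (U : cell -> finType) (i : cell) (S : {set user k i})
    (w : outcome C Q U) : {dffun forall j : {j : user k i | j \in S}, ch_in C (val j)} :=
  [ffun j : {j : user k i | j \in S} => w.1.2 i (val j)].

Definition rvY (R : realType) (k : cell -> nat) (C : mac_ic_mac R k)
    (Q : finType) (U : cell -> finType) (i : cell) (w : outcome C Q U) : ch_out C i :=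
  w.2 i.

Definition infoA (R : realType) (k : cell -> nat) (C : mac_ic_mac R k)
    (Q : finType) (U : cell -> finType) (P : coding C Q U -> R)
    (i : cell) (S : {set user k i}) : R :=
  cond_mutual_info (joint_dist P)
    (fun w => rvX S w)
    (fun w => rvY i w)
    (fun w => (rvX (~: S) w, rvU i w, rvU (~~ i) w, rvQ w)).

Definition infoB (R : realType) (k : cell -> nat) (C : mac_ic_mac R k)
    (Q : finType) (U : cell -> finType) (P : coding C Q U -> R)
    (i : cell) (S : {set user k i}) : R :=
  cond_mutual_info (joint_dist P)
    (fun w => rvX S w)
    (fun w => rvY i w)
    (fun w => (rvX (~: S) w, rvU (~~ i) w, rvQ w)).

Definition infoE (R : realType) (k : cell -> nat) (C : mac_ic_mac R k)
    (Q : finType) (U : cell -> finType) (P : coding C Q U -> R)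
    (i : cell) (S : {set user k i}) : R :=
  cond_mutual_info (joint_dist P)
    (fun w => (rvX S w, rvU (~~ i) w))
    (fun w => rvY i w)
    (fun w => (rvX (~: S) w, rvU i w, rvQ w)).

Definition infoG (R : realType) (k : cell -> nat) (C : mac_ic_mac R k)
    (Q : finType) (U : cell -> finType) (P : coding C Q U -> R)
    (i : cell) (S : {set user k i}) : R :=
  cond_mutual_info (joint_dist P)
    (fun w => (rvX S w, rvU (~~ i) w))
    (fun w => rvY i w)
    (fun w => (rvX (~: S) w, rvQ w)).

Definition sum_rate (R : realType) (k : cell -> nat) (r : rates R k)
    (i : cell) (S : {set user k i}) : R := \sum_(j in S) rate r j.

Definition inner_region (R : realType) (k : cell -> nat) (C : mac_ic_mac R k)
    (Q : finType) (U : cell -> finType) (P : coding C Q U -> R) : set (rates R k) :=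
  [set r : rates R k | nonneg_rates r /\
    forall (V1 W1 : {set user k cell1}) (V2 W2 : {set user k cell2}),
      user1 k cell1 \in V1 -> W1 != finset.set0 ->
      user1 k cell2 \in V2 -> W2 != finset.set0 ->
      (sum_rate r W1 <= infoB P W1) /\
      (sum_rate r V1 <= infoA P V1 + infoE P V2) /\
      (sum_rate r W2 <= infoB P W2) /\
      (sum_rate r V2 <= infoE P V1 + infoA P V2) /\
      (sum_rate r V1 + sum_rate r W2 <= infoA P V1 + infoG P W2) /\
      (sum_rate r W1 + sum_rate r V2 <= infoG P W1 + infoA P V2) /\
      (sum_rate r V1 + sum_rate r V2 <= infoE P V1 + infoE P V2) /\
      (sum_rate r V1 + sum_rate r W1 + sum_rate r V2
         <= infoA P V1 + infoG P W1 + infoE P V2) /\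
      (sum_rate r V1 + sum_rate r V2 + sum_rate r W2
         <= infoE P V1 + infoA P V2 + infoG P W2)].

(* Main.v *)
(* Random coding with superposition, time sharing and rate splitting: user i.1
   splits its message into a common part, carried by U_i and decoded by both
   receivers, and a private part.  The codebook is drawn i.i.d. in time from
   independent seeds: the superposition structure is put into the seeds, which
   are functions of the symbols they are superposed on.  Receiver i decodes its
   own messages and the other common part jointly by maximum likelihood, for the
   channel averaged over the remaining interference.

   An error on v forces W(y|v') >= W(y|v) for a competitor v', so its indicator
   is at most the sum of the likelihood ratios.  Averaging over the codewords of
   the competitors given the sent one turns the ratios of the N_E competitors
   that differ from v exactly on E into N_E * avg_E W / W.  Since an indicator is
   at most 1, each term may be raised to a power 0 < sigma <= 1; the bound then
   factors over time, and its exponent has at sigma = 0 the derivative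
   rate(E) - I_E.  This decays for small sigma when rate(E) < I_E, and there are
   no competitors when rate(E) = 0, so scaling the rates by 1 - epsilon suffices.
   Eliminating the private rates from the conditions rate(E) <= I_E leaves the
   nine families of inequalities of the region, up to inequalities that follow
   from the monotonicity of I_E in E. *)
Require Import Defs.
From mathcomp Require Import all_boot all_order all_algebra.
From mathcomp Require Import all_classical all_reals all_analysis.
From mathcomp Require Import ring lra.

Set Implicit Arguments.
Unset Strict Implicit.
Unset Printing Implicit Defensive.

Import Order.TTheory GRing.Theory Num.Theory.
Import numFieldNormedType.Exports.
Local Open Scope ring_scope.

(** * Independent seeds and resampling *)

Lemma prod_sum_dffun (R : comPzSemiRingType) (I : finType) (T : I -> finType)
    (F : forall i, T i -> R) :
  \prod_i \sum_(x : T i) F i x =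
  \sum_(f : {dffun forall i, T i}) \prod_i F i (f i).
Proof.
rewrite (reindex (@dffun_of_fprod I T)); last exact/onW_bij/dffun_of_fprod_bij.
transitivity (\sum_(f : fprod T) \prod_(i in I) [ffun x => F i x] (f i)).
  rewrite (@big_fprod R 0 1 *%R +%R I T (fun i => [ffun x => F i x])).
  rewrite -(@bigA_distr_big_dep _ _ _ _ _ _ _ (fun i => tagged_with T i)
      (fun i => untag 0 [ffun x => F i x])).
  apply: eq_bigr => i _.
  by rewrite -(big_tag (fun i x => [ffun x => F i x] x)); apply: eq_bigr => x _; rewrite ffunE.
by apply: eq_bigr => f _; apply: eq_bigr => i _; rewrite !ffunE.
Qed.

Section Resample.
Variables (R : realType) (L : finType) (S : L -> finType) (p : forall l, S l -> R).
Hypothesis pD : forall l, is_dist (@p l).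

Notation seeds := {dffun forall l, S l}.

Definition indep_law (z : seeds) : R := \prod_l p (z l).

Lemma indep_law_dist : is_dist indep_law.
Proof.
split=> [z|]; first by apply: prodr_ge0 => l _; case: (pD l).
by rewrite -prod_sum_dffun big1 // => l _; case: (pD l).
Qed.

Definition mix (E : {set L}) (b a : seeds) : seeds :=
  [ffun l => if l \in E then b l else a l].

(** The conditional expectation of [f] given the coordinates outside [E], written without division
    so that it makes sense also at seeds of probability 0. *)
Definition resample (E : {set L}) (f : seeds -> R) (a : seeds) : R :=
  \sum_b indep_law b * f (mix E b a).

Lemma mixK E a b : mix E (mix E a b) (mix E b a) = a.
Proof. apply/ffunP => l; rewrite !ffunE. by case: ifP => // ->. Qed.

Lemma indep_law_mix E a b :
  indep_law (mix E b a) * indep_law (mix E a b) = indep_law a * indep_law b.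
Proof.
rewrite /indep_law -!big_split /=; apply: eq_bigr => l _.
by rewrite !ffunE; case: ifP => // _; rewrite mulrC.
Qed.

(** Exchanging the coordinates in [E] between two independent copies is an involution that preserves
    their product law. *)
Lemma sum_resample2 E (f : seeds -> seeds -> R) :
  \sum_a \sum_b indep_law a * indep_law b * f a b =
  \sum_a \sum_b indep_law a * indep_law b * f (mix E b a) (mix E a b).
Proof.
rewrite !pair_big /=.
rewrite (reindex (fun ab : seeds * seeds => (mix E ab.2 ab.1, mix E ab.1 ab.2))) /=.
  by apply: eq_bigr => -[a b] _ /=; rewrite indep_law_mix.
exists (fun ab : seeds * seeds => (mix E ab.2 ab.1, mix E ab.1 ab.2)) => -[a b] _ /=;
  by rewrite !mixK.
Qed.

Definition untouched (E : {set L}) (A : Type) (g : seeds -> A) : Prop :=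
  forall b a, g (mix E b a) = g a.

Lemma resample_expect E (f g : seeds -> R) : untouched E g ->
  \sum_a indep_law a * (g a * f a) = \sum_a indep_law a * (g a * resample E f a).
Proof.
move=> gE.
transitivity (\sum_a \sum_b indep_law a * indep_law b * (g a * f a)).
  apply: eq_bigr => a _; rewrite -mulr_suml -mulr_sumr.
  by case: indep_law_dist => _ ->; rewrite mulr1.
rewrite (sum_resample2 E); apply: eq_bigr => a _.
rewrite /resample !mulr_sumr; apply: eq_bigr => b _; rewrite gE; ring.
Qed.

Lemma resample_untouched E f : untouched E (resample E f).
Proof.
move=> b a; apply: eq_bigr => c _; congr (_ * f _).
by apply/ffunP => l; rewrite !ffunE; case: ifP => // ->.
Qed.

Lemma untouchedS (E F : {set L}) A (g : seeds -> A) :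
  E \subset F -> untouched F g -> untouched E g.
Proof.
move=> /fintype.subsetP EF gF b a; rewrite -(gF a (mix E b a)) -[RHS](gF a); congr g.
apply/ffunP => l; rewrite !ffunE; case: ifP => // lF; case: ifP => // /EF.
by rewrite lF.
Qed.

(** The two rounds together put the seed [mix F c b] on the union; by the exchange argument this
    mixture of two independent samples has the law of one sample. *)
Lemma resample_resample E F f :
  resample E (resample F f) = resample (E :|: F) f.
Proof.
apply/funext => a; rewrite /resample.
transitivity (\sum_b \sum_c indep_law b * indep_law c * f (mix (E :|: F) (mix F c b) a)).
  apply: eq_bigr => b _; rewrite mulr_sumr; apply: eq_bigr => c _.
  rewrite mulrA; congr (_ * f _); apply/ffunP => l; rewrite !ffunE inE.
  by case: (l \in F); case: (l \in E).
rewrite -(sum_resample2 F (fun x _ => f (mix (E :|: F) x a))).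
apply: eq_bigr => b _; rewrite -mulr_suml -mulr_sumr.
by case: indep_law_dist => _ ->; rewrite mulr1.
Qed.

Lemma resample_ge0 E f : (forall z, 0 <= f z) -> forall z, 0 <= resample E f z.
Proof.
move=> f0 z; apply: sumr_ge0 => b _; apply: mulr_ge0 => //.
by case: indep_law_dist.
Qed.

Lemma mix_id E (a : seeds) : mix E a a = a.
Proof. by apply/ffunP => l; rewrite ffunE; case: ifP. Qed.

Lemma resample_gt0 E f z : (forall z, 0 <= f z) ->
  0 < indep_law z -> 0 < f z -> 0 < resample E f z.
Proof.
move=> f0 pz fz; rewrite /resample (bigD1 z) //= mix_id ltr_pwDl ?mulr_gt0 //.
by apply: sumr_ge0 => b _; apply: mulr_ge0 => //; case: indep_law_dist.
Qed.

Lemma resample_sum E (B : finType) (f : seeds -> B -> R) z :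
  (forall z, \sum_b f z b = 1) -> \sum_b resample E (fun z => f z b) z = 1.
Proof.
move=> f1; rewrite exchange_big /=.
transitivity (\sum_z indep_law z); last by case: indep_law_dist.
by apply: eq_bigr => c _; rewrite -mulr_sumr f1 mulr1.
Qed.

End Resample.

(** * Random codebooks *)

Lemma eq_dffun_prod (R : comPzSemiRingType) (I : finType) (T : I -> finType)
    (f g : {dffun forall i, T i}) :
  (f == g)%:R = \prod_i (f i == g i)%:R :> R.
Proof.
have [->|fg] := eqVneq f g; first by rewrite big1 // => i _; rewrite eqxx.
have [i fgi] : exists i, f i != g i.
  apply/existsP; rewrite -negb_forall; apply: contra fg => /forallP fg.
  by apply/eqP/ffunP => i; apply/eqP.
by rewrite (bigD1 i) //= (negbTE fgi) mul0r.
Qed.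

Lemma sum_pick (R : pzSemiRingType) (T : finType) (f : T -> R) a :
  \sum_x f x * (x == a)%:R = f a.
Proof.
rewrite (bigD1 a) //= eqxx mulr1 big1 ?addr0 // => x /negbTE ->.
by rewrite mulr0.
Qed.

Section FunLaw.
Variables (R : realType) (A B : finType) (p : A -> B -> R).
Hypothesis pD : forall a, is_dist (p a).

Definition fun_law (c : {ffun A -> B}) : R := \prod_a p a (c a).

Lemma fun_law_dist : is_dist fun_law.
Proof.
split=> [c|]; first by apply: prodr_ge0 => a _; case: (pD a).
by rewrite -bigA_distr_bigA big1 // => a _; case: (pD a).
Qed.

Lemma fun_law_eval2 a1 a2 x y :
  \sum_c fun_law c * ((c a1 == x)%:R * (c a2 == y)%:R) =
  if a1 == a2 then p a1 x * (x == y)%:R else p a1 x * p a2 y.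
Proof.
transitivity (\sum_(c : {ffun A -> B}) \prod_a (p a (c a) *
    ((if a == a1 then (c a == x)%:R else 1) * (if a == a2 then (c a == y)%:R else 1)))).
  apply: eq_bigr => c _; rewrite !big_split /= -!big_mkcond /= !big_pred1_eq.
  by rewrite mulrA.
rewrite -(bigA_distr_bigA (fun a b => p a b * ((if a == a1 then (b == x)%:R else 1) *
   (if a == a2 then (b == y)%:R else 1)))).
rewrite (bigD1 a1) //= eqxx; have [<-|a12] := eqVneq a1 a2.
  rewrite [X in _ * X]big1 ?mulr1; last first.
    move=> a /negbTE ->; under eq_bigr do rewrite !mulr1.
    by case: (pD a).
  rewrite -(sum_pick (fun b => p a1 b * (b == y)%:R)); apply: eq_bigr => b _; ring.
rewrite [in X in _ * X](bigD1 a2) 1?eq_sym //= eqxx.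
rewrite [X in _ * (_ * X)]big1 ?mulr1; last first.
  move=> a /andP[/negbTE -> /negbTE ->]; under eq_bigr do rewrite !mulr1.
  by case: (pD a).
rewrite (negbTE a12); congr (_ * _).
  by rewrite -[RHS]sum_pick; apply: eq_bigr => b _; rewrite mulr1.
by rewrite -[RHS]sum_pick; apply: eq_bigr => b _; rewrite mul1r.
Qed.

Lemma fun_law_eval a x : \sum_c fun_law c * (c a == x)%:R = p a x.
Proof.
transitivity (\sum_c fun_law c * ((c a == x)%:R * (c a == x)%:R)).
  by apply: eq_bigr => c _; rewrite -natrM mulnb andbb.
by rewrite fun_law_eval2 !eqxx mulr1.
Qed.

End FunLaw.

Section Codebook.
Variables (R : realType) (L : finType) (S : L -> finType) (p : forall l, S l -> R).
Hypothesis pD : forall l, is_dist (@p l).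
Variables (D : finType) (s : D -> nat) (dep : L -> {set D}).

Notation seeds := {dffun forall l, S l}.

Definition messages_of : finType := {dffun forall d, 'I_(s d).+1}.

Definition codebook : finType := {dffun forall l, {ffun messages_of -> S l}}.

Definition codebook_law : codebook -> R :=
  indep_law (fun l => fun_law (fun=> @p l)).

(** Components outside [dep l] are reset to [ord0], so that messages which agree on [dep l] read the
    same entry of slot [l], and all others read independent entries. *)
Definition codeword_index (l : L) (v : messages_of) : messages_of :=
  [ffun d => if d \in dep l then v d else ord0].

Definition codeletter (w : codebook) (v : messages_of) : seeds :=
  [ffun l => w l (codeword_index l v)].

Definition diff_set (v v' : messages_of) : {set D} := [set d | v d != v' d].

Definition touched (E : {set D}) : {set L} := [set l | ~~ [disjoint dep l & E]].

Lemma codeword_index_eq l v v' : (codeword_index l v == codeword_index l v') = (l \notin touched (diff_set v v')).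
Proof.
rewrite inE negbK; apply/eqP/idP => [vv'|].
  rewrite disjoint_subset; apply/fintype.subsetP => d dl; rewrite !inE negbK.
  by have /ffunP/(_ d) := vv'; rewrite !ffunE dl => ->.
move=> /disjointFr dvv'; apply/ffunP => d; rewrite !ffunE; case: ifP => // /dvv'.
by rewrite inE => /negbFE/eqP.
Qed.

Lemma codeletter_pair v v' a b :
  \sum_w codebook_law w * ((codeletter w v == a)%:R * (codeletter w v' == b)%:R) =
  indep_law p a * \prod_l (if l \in touched (diff_set v v') then p (b l) else (a l == b l)%:R).
Proof.
transitivity (\sum_(w : codebook) \prod_l (fun_law (fun=> @p l) (w l) *
    ((w l (codeword_index l v) == a l)%:R * (w l (codeword_index l v') == b l)%:R))).
  apply: eq_bigr => w _; rewrite !eq_dffun_prod -!big_split /=.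
  by apply: eq_bigr => l _; rewrite !ffunE.
rewrite -(prod_sum_dffun (fun l (c : {ffun messages_of -> S l}) => fun_law (fun=> @p l) c *
    ((c (codeword_index l v) == a l)%:R * (c (codeword_index l v') == b l)%:R))).
rewrite -big_split /=; apply: eq_bigr => l _.
by rewrite (fun_law_eval2 (fun=> pD l)) codeword_index_eq; case: (l \in _).
Qed.

(** Given the letter of the sent message, a competitor shares the seeds of the slots that do not see
    the difference and has fresh ones elsewhere. This turns averages over codebooks into
    [resample]. *)
Lemma codeletter_cond v v' a (g : seeds -> R) :
  \sum_w codebook_law w * ((codeletter w v == a)%:R * g (codeletter w v')) =
  indep_law p a * resample p (touched (diff_set v v')) g a.
Proof.
transitivity (\sum_b g b * \sum_w codebook_law w *
    ((codeletter w v == a)%:R * (codeletter w v' == b)%:R)).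
  under [RHS]eq_bigr do rewrite mulr_sumr.
  rewrite exchange_big /=; apply: eq_bigr => w _.
  rewrite -[g _](sum_pick g) !mulr_sumr; apply: eq_bigr => b _.
  rewrite [b == _]eq_sym; ring.
under eq_bigr do rewrite codeletter_pair.
rewrite /resample mulr_sumr.
set E := touched _.
transitivity (\sum_b g b * (indep_law p a * \sum_c indep_law p c * (mix E c a == b)%:R)).
  apply: eq_bigr => b _; congr (_ * (_ * _)).
  transitivity (\sum_(c : seeds) \prod_l (p (c l) * ((if l \in E then c l else a l) == b l)%:R)).
    rewrite -(prod_sum_dffun (fun l x => p x * ((if l \in E then x else a l) == b l)%:R)).
    apply: eq_bigr => l _; case: ifP => _; first by rewrite sum_pick.
    by rewrite -mulr_suml; case: (pD l) => _ ->; rewrite mul1r.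
  apply: eq_bigr => c _; rewrite eq_dffun_prod -big_split /=.
  by apply: eq_bigr => l _; rewrite !ffunE.
under eq_bigr do rewrite !mulr_sumr.
rewrite exchange_big /=; apply: eq_bigr => c _.
rewrite -[g (mix _ _ _)](sum_pick g) !mulr_sumr; apply: eq_bigr => b _.
rewrite [b == _]eq_sym; ring.
Qed.

Lemma codebook_law_dist : is_dist codebook_law.
Proof. by apply: indep_law_dist => l; apply: fun_law_dist. Qed.

Lemma codeletter_law v a :
  \sum_w codebook_law w * (codeletter w v == a)%:R = indep_law p a.
Proof.
transitivity (\sum_w codebook_law w * ((codeletter w v == a)%:R * (fun=> 1) (codeletter w v))).
  by apply: eq_bigr => w _; rewrite mulr1.
rewrite (codeletter_cond v v a (fun=> 1)) /resample -mulr_suml.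
by case: (indep_law_dist pD) => _ ->; rewrite !mulr1.
Qed.

Lemma card_diff v (E : {set D}) :
  #|[pred v' | diff_set v v' == E]| = (\prod_(d in E) s d)%N.
Proof.

pose F d := [pred x : 'I_(s d).+1 | (x != v d) == (d \in E)].
have -> : #|[pred v' | diff_set v v' == E]| =
    #|(family F : simpl_pred {dffun forall d, 'I_(s d).+1})|.
  apply: eq_card => v'; rewrite !inE; apply/eqP/familyP => [Ed d|fv].
    by rewrite !inE -Ed inE [v' d == _]eq_sym.
  by apply/setP => d; rewrite inE eq_sym; have := fv d; rewrite inE => /eqP.
rewrite card_family foldrE big_image /= [RHS]big_mkcond /=; apply: eq_bigr => d _.
case: ifP => dE.
  rewrite -[RHS]/(s d).+1.-1 -[in RHS](card_ord (s d).+1) -(cardC1 (v d)).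
  by apply: eq_card => x; exact: eqb_id.
transitivity #|pred1 (v d)|; last exact: card1.
by apply: eq_card => x; exact: etrans (eqbF_neg _) (negbK _).
Qed.

End Codebook.

(** * Joint maximum likelihood decoding *)

(** If some [c i] is at least 1, its power alone is at least 1; otherwise all [c i] are below 1 and
    powers of exponent at most 1 do not decrease them. *)
Lemma le1_sum_powR (R : realType) (I : finType) (B : pred I) (c s : I -> R) x :
  (forall i, 0 <= c i) -> (forall i, 0 < s i <= 1) -> x <= 1 ->
  x <= \sum_(i | B i) c i -> x <= \sum_(i | B i) c i `^ s i.
Proof.
move=> c0 s01 x1 xc.
have [/existsP[i /andP[Bi ci]]|/existsPn cB] := boolP [exists i, B i && (1 <= c i)].
  apply: le_trans x1 _; rewrite (bigD1 i) //=.
  apply: (@le_trans _ _ (c i `^ s i)).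
    by rewrite -[leLHS](powRr0 (c i)); apply: ler_powR => //; case/andP: (s01 i) => /ltW.
  by rewrite lerDl; apply: sumr_ge0 => j _; exact: powR_ge0.
apply: le_trans xc _; apply: ler_sum => i Bi.
have := cB i; rewrite Bi /= -ltNge => /ltW ci1.
have [ci0|ci0] := ltrP 0 (c i).
  by apply: ger1_powR; [rewrite ci0|case/andP: (s01 i)].
by apply: le_trans ci0 _; exact: powR_ge0.
Qed.

Lemma prod_powR (R : realType) (I : finType) (c : I -> R) s :
  (forall i, 0 <= c i) -> (\prod_i c i) `^ s = \prod_i c i `^ s.
Proof.
move=> c0.
suff [] : 0 <= \prod_i c i /\ (\prod_i c i) `^ s = \prod_i c i `^ s by [].
apply: (big_ind2 (fun x y => 0 <= x /\ x `^ s = y)) => [|x _ y _ [x0 <-] [y0 <-]|i _] //.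
  by rewrite powR1.
by split; [exact: mulr_ge0|exact: powRM].
Qed.

Section RandomCoding.
Variables (R : realType) (L : finType) (S : L -> finType) (p : forall l, S l -> R).
Hypothesis pD : forall l, is_dist (@p l).
Variables (D : finType) (s : D -> nat) (dep : L -> {set D}).
Variables (Y : finType) (V W : {dffun forall l, S l} -> Y -> R).
Hypothesis VD : forall z, is_dist (V z).
Hypothesis W0 : forall z y, 0 <= W z y.
Hypothesis VW : forall z y, 0 < indep_law p z -> 0 < V z y -> 0 < W z y.
Variables (n : nat) (Bad : pred {set D}).

Notation seeds := {dffun forall l, S l}.
Notation msg := (messages_of s).
Notation book := {ffun 'I_n -> codebook S s}.

Definition book_law (w : book) : R := \prod_t codebook_law p (w t).

Definition letters (w : book) (v : msg) (t : 'I_n) : seeds := codeletter dep (w t) v.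

(** [V] is the true law of the output, [W] the metric of the decoder. Ties count as errors. *)
Definition ml_error (w : book) (v : msg) (y : {ffun 'I_n -> Y}) : bool :=
  [exists v' : msg, Bad (diff_set v v') &&
     (\prod_t W (letters w v t) (y t) <= \prod_t W (letters w v' t) (y t))].

(** The mean likelihood ratio, given the sent letter [z], of a competitor that differs from the sent
    message exactly on [E]. *)
Definition ratio (E : {set D}) (z : seeds) (y : Y) : R :=
  resample p (touched dep E) (W^~ y) z / W z y.

Lemma ratio_ge0 E z y : 0 <= ratio E z y.
Proof. by apply: divr_ge0 => //; exact: (resample_ge0 pD). Qed.

Lemma book_law_dist : is_dist book_law.
Proof.
have cD := codebook_law_dist pD s.
split=> [w|]; first by apply: prodr_ge0 => t _; case: cD.
rewrite -(bigA_distr_bigA (fun=> codebook_law (s := s) p)) big1 // => t _.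
by case: cD.
Qed.

Lemma letters_cond (a : {ffun 'I_n -> seeds}) v v' (g : 'I_n -> seeds -> R) :
  \sum_w book_law w * ((finfun (letters w v) == a)%:R * \prod_t g t (letters w v' t)) =
  (\prod_t indep_law p (a t)) *
    \prod_t resample p (touched dep (diff_set v v')) (g t) (a t).
Proof.
rewrite -big_split /=.
under [RHS]eq_bigr => t _ do rewrite -codeletter_cond //.
rewrite bigA_distr_bigA; apply: eq_bigr => w _.
rewrite !big_split /=; congr (_ * (_ * _)).
by rewrite eq_dffun_prod; apply: eq_bigr => t _; rewrite ffunE.
Qed.

Lemma letters_law (a : {ffun 'I_n -> seeds}) v :
  \sum_w book_law w * (finfun (letters w v) == a)%:R = \prod_t indep_law p (a t).
Proof.
under [RHS]eq_bigr => t _ do rewrite -(codeletter_law pD dep v).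
rewrite bigA_distr_bigA; apply: eq_bigr => w _.
rewrite !big_split /=; congr (_ * _).
by rewrite eq_dffun_prod; apply: eq_bigr => t _; rewrite ffunE.
Qed.

Lemma ml_error_cond (sg : {set D} -> R) (a : {ffun 'I_n -> seeds}) (y : {ffun 'I_n -> Y}) v :
  (forall E, 0 < sg E <= 1) ->
  (\prod_t V (a t) (y t)) *
    \sum_w book_law w * ((finfun (letters w v) == a)%:R * (ml_error w v y)%:R) <=
  (\prod_t indep_law p (a t)) * (\prod_t V (a t) (y t)) *
    \sum_(E | Bad E) ((\prod_(d in E) s d)%N%:R * \prod_t ratio E (a t) (y t)) `^ sg E.
Proof.
move=> sg01; set q := \sum_w _; set A := \prod_t indep_law p (a t).
set v0 := \prod_t V _ _.
have A0 : 0 <= A by apply: prodr_ge0 => t _; case: (indep_law_dist pD).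
have v00 : 0 <= v0 by apply: prodr_ge0 => t _; case: (VD (a t)).
have bw0 w : 0 <= book_law w by case: book_law_dist.
have qA : q <= A.
  rewrite /q /A -(letters_law a v); apply: ler_sum => w _.
  by apply: ler_wpM2l => //; rewrite ler_piMr // lern1 leq_b1.
have q0 : 0 <= q by apply: sumr_ge0 => w _; rewrite !mulr_ge0.
(* Letters and outputs of probability 0 are set aside, since the likelihood of the sent message may
   vanish there; elsewhere [VW] makes it positive. *)
have [Av0|Av0] := eqVneq (A * v0) 0.
  rewrite Av0 mul0r; have /eqP := Av0; rewrite mulf_eq0 => /orP[/eqP A_0|/eqP->]; last by rewrite mul0r.
  have -> : q = 0 by apply/eqP; rewrite eq_le q0 -A_0 qA.
  by rewrite mulr0.
have Apos : 0 < A by rewrite lt_def A0 andbT; apply: contra Av0 => /eqP->; rewrite mul0r.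
have vpos : 0 < v0 by rewrite lt_def v00 andbT; apply: contra Av0 => /eqP->; rewrite mulr0.
have Wpos t : 0 < W (a t) (y t).
  apply: VW.
    rewrite lt_def; case: (indep_law_dist pD) => -> _; rewrite andbT.
    by apply: contraTneq Apos => at0; rewrite /A (bigD1 t) //= at0 mul0r ltxx.
  rewrite lt_def; case: (VD (a t)) => -> _; rewrite andbT.
  by apply: contraTneq vpos => at0; rewrite /v0 (bigD1 t) //= at0 mul0r ltxx.
have Wapos : 0 < \prod_t W (a t) (y t) by apply: prodr_gt0.
rewrite [A * v0]mulrC -mulrA ler_wpM2l //.
rewrite -ler_pdivrMl // mulrC.
(* [q / A] is the conditional error probability given the sent letters, hence at most 1; it remains
   to bound it without the powers. *)
apply: le1_sum_powR => //.
- by move=> E; apply: mulr_ge0 => //; apply: prodr_ge0 => t _; exact: ratio_ge0.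
- by rewrite ler_pdivrMr // mul1r.
rewrite ler_pdivrMr //.
(* The likelihood ratio of [v'], which is at least 1 when [v'] beats or ties the sent message. *)
pose rr w v' := \prod_t W (letters w v' t) (y t) / \prod_t W (a t) (y t).
have rr0 w v' : 0 <= rr w v' by apply: divr_ge0; [apply: prodr_ge0|exact: ltW].
apply: (@le_trans _ _ (\sum_w book_law w * ((finfun (letters w v) == a)%:R *
    \sum_(v' | Bad (diff_set v v')) rr w v'))).
  apply: ler_sum => w _; apply: ler_wpM2l => //.
  have [aE|_] := eqVneq (finfun (letters w v)) a; last by rewrite !mul0r.
  rewrite !mul1r; case E : (ml_error w v y); last by apply: sumr_ge0.
  move/existsP: E => [v' /andP[Bv' le_v']].
  rewrite (bigD1 v') //=.
  apply: (@le_trans _ _ (rr w v')); last by rewrite lerDl; apply: sumr_ge0.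
  rewrite /rr ler_pdivlMr // mul1r; apply: le_trans le_v'.
  by rewrite -aE; under eq_bigr do rewrite ffunE.
rewrite [leLHS](_ : _ = \sum_(v' | Bad (diff_set v v')) A * \prod_t ratio (diff_set v v') (a t) (y t)).
  rewrite (partition_big (diff_set v) Bad) //= mulr_suml; apply: ler_sum => E BE.
  rewrite (eq_bigr (fun=> A * \prod_t ratio E (a t) (y t))); last first.
    by move=> v' /andP[_ /eqP->].
  rewrite (eq_bigl [pred v' | diff_set v v' == E]); last first.
    by move=> v' /=; case: eqP => [->|]; rewrite ?BE ?andbF.
  by rewrite sumr_const card_diff -[leLHS]mulr_natl mulrCA mulrC.
under [LHS]eq_bigr => w _ do rewrite mulr_sumr mulr_sumr.
rewrite exchange_big /=; apply: eq_bigr => v' _.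
transitivity ((\sum_w book_law w * ((finfun (letters w v) == a)%:R *
    \prod_t W (letters w v' t) (y t))) / \prod_t W (a t) (y t)).
  by rewrite mulr_suml; apply: eq_bigr => w _; rewrite /rr !mulrA.
rewrite (letters_cond a v v' (fun t z => W z (y t))).
by rewrite -mulrA prodf_div.
Qed.

Lemma random_coding (sg : {set D} -> R) v :
  (forall E, 0 < sg E <= 1) ->
  \sum_w book_law w * (\sum_(y : {ffun 'I_n -> Y})
     (\prod_t V (letters w v t) (y t)) * (ml_error w v y)%:R) <=
  \sum_(E | Bad E) (\prod_(d in E) s d)%N%:R `^ sg E *
     (\sum_z \sum_y indep_law p z * V z y * ratio E z y `^ sg E) ^+ n.
Proof.
move=> sg01.
rewrite [leLHS](_ : _ = \sum_(a : {ffun 'I_n -> seeds}) \sum_(y : {ffun 'I_n -> Y})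
   (\prod_t V (a t) (y t)) *
    \sum_w book_law w * ((finfun (letters w v) == a)%:R * (ml_error w v y)%:R)); last first.
  transitivity (\sum_w \sum_(a : {ffun 'I_n -> seeds}) \sum_(y : {ffun 'I_n -> Y})
      (\prod_t V (a t) (y t)) *
      (book_law w * ((finfun (letters w v) == a)%:R * (ml_error w v y)%:R))).
    apply: eq_bigr => w _; rewrite exchange_big mulr_sumr; apply: eq_bigr => y _ /=.
    rewrite (bigD1 (finfun (letters w v))) //= [X in _ = _ + X]big1 ?addr0.
      rewrite eqxx mul1r [RHS]mulrCA; congr (_ * (_ * _)).
      by apply: eq_bigr => t _; rewrite ffunE.
    by move=> a; rewrite eq_sym => /negbTE ->; rewrite mul0r !mulr0.
  rewrite exchange_big; apply: eq_bigr => a _; rewrite exchange_big; apply: eq_bigr => y _.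
  by rewrite mulr_sumr.
apply: (@le_trans _ _ (\sum_(a : {ffun 'I_n -> seeds}) \sum_(y : {ffun 'I_n -> Y})
  (\prod_t indep_law p (a t)) * (\prod_t V (a t) (y t)) *
    \sum_(E | Bad E) ((\prod_(d in E) s d)%N%:R * \prod_t ratio E (a t) (y t)) `^ sg E)).
  by apply: ler_sum => a _; apply: ler_sum => y _; exact: ml_error_cond.
(* Only equalities remain: the power and the sums over letters and outputs factor over time. *)
rewrite le_eqVlt; apply/orP; left; apply/eqP.
transitivity (\sum_(a : {ffun 'I_n -> seeds}) \sum_(E | Bad E) \sum_(y : {ffun 'I_n -> Y})
  (\prod_t indep_law p (a t)) * (\prod_t V (a t) (y t)) *
    ((\prod_(d in E) s d)%N%:R * \prod_t ratio E (a t) (y t)) `^ sg E).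
  apply: eq_bigr => a _; rewrite [RHS]exchange_big /=.
  by apply: eq_bigr => y _; rewrite mulr_sumr.
rewrite exchange_big /=; apply: eq_bigr => E _.
transitivity (\sum_(a : {ffun 'I_n -> seeds}) \sum_(y : {ffun 'I_n -> Y})
   (\prod_(d in E) s d)%N%:R `^ sg E *
   \prod_t (indep_law p (a t) * V (a t) (y t) * ratio E (a t) (y t) `^ sg E)).
  apply: eq_bigr => a _; apply: eq_bigr => y _.
  rewrite powRM //; last by apply: prodr_ge0 => t _; exact: ratio_ge0.
  rewrite prod_powR; last by move=> t; exact: ratio_ge0.
  rewrite [in RHS]big_split [X in _ = _ * (X * _)]big_split /=.
  by rewrite mulrCA.
transitivity ((\prod_(d in E) s d)%N%:R `^ sg E *
   \sum_(a : {ffun 'I_n -> seeds}) \sum_(y : {ffun 'I_n -> Y})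
   \prod_t (indep_law p (a t) * V (a t) (y t) * ratio E (a t) (y t) `^ sg E)).
  by rewrite mulr_sumr; apply: eq_bigr => a _; rewrite mulr_sumr.
congr (_ * _).
transitivity (\sum_(a : {ffun 'I_n -> seeds})
   \prod_t \sum_y indep_law p (a t) * V (a t) y * ratio E (a t) y `^ sg E).
  by apply: eq_bigr => a _; rewrite bigA_distr_bigA.
rewrite -(bigA_distr_bigA (fun (t : 'I_n) z =>
  \sum_y indep_law p z * V z y * ratio E z y `^ sg E)).
by rewrite prodr_const card_ord.
Qed.

End RandomCoding.

(** * Exponents and information *)

(** From [1 - x <= expR (- x)]; what remains is [0 <= x ^+ 2 * (1 - 2 * x)]. *)
Lemma expR_le_quadratic (R : realType) (x : R) : x <= 1 / 2 -> expR x <= 1 + x + 2 * x ^+ 2.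
Proof.
move=> x2.
have e0 : 0 < 1 - x by lra.
have : expR x <= (1 - x)^-1.
  rewrite -[x in expR x]opprK expRN lef_pV2 ?posrE ?expR_gt0 //.
  exact: expR_ge1Dx.
move=> /le_trans; apply; rewrite -div1r ler_pdivrMr //.
by nra.
Qed.

(** The quantity to bound is the mean of [expR (s * x t)], where [x t = r + ln (rho t)] has the
    negative mean [- g]. Its derivative at [s = 0] is therefore negative, and a second-order bound
    makes a suitable [s] explicit. *)
Lemma exists_tilt (R : realType) (T : finType) (q rho : T -> R) (r : R) :
  is_dist q -> (forall t, 0 < q t -> 0 < rho t) ->
  r < - \sum_t q t * ln (rho t) ->
  exists2 s, 0 < s <= 1 & expR (s * r) * \sum_t q t * rho t `^ s < 1.
Proof.
move=> [q0 q1] qrho rI.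
pose x t := r + ln (rho t).
pose B := 1 + \sum_t `|x t|.
pose g := - \sum_t q t * x t.
have g0 : 0 < g.
  rewrite /g /x; under eq_bigr do rewrite mulrDr.
  rewrite big_split /= -mulr_suml q1; lra.
have xB t : `|x t| <= B.
  rewrite /B (bigD1 t) //= addrCA lerDl addr_ge0 //.
  by apply: sumr_ge0.
have B1 : 1 <= B by rewrite /B lerDl; apply: sumr_ge0.
have B0 : 0 < B by lra.
(* The first bound gives [s * B <= 1 / 2], as [expR_le_quadratic] requires; the second gives
   [4 * (s * B) ^+ 2 <= s * g], so that the quadratic term takes at most half of the linear gain. *)
pose s := Num.min (2 * B)^-1 (g / (4 * B ^+ 2)).
have s0 : 0 < s.
  by rewrite lt_min invr_gt0 divr_gt0 ?andbT ?mulr_gt0 // exprn_gt0.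
have sB : s * B <= 1 / 2.
  rewrite -ler_pdivlMr //; apply: le_trans (_ : (2 * B)^-1 <= _).
    by rewrite /s ge_min lexx.
  by rewrite invfM div1r.
have s1 : s <= 1.
  have : s <= s * B by rewrite ler_peMr // ltW.
  by lra.
exists s; first by rewrite s0.
have -> : expR (s * r) * \sum_t q t * rho t `^ s = \sum_t q t * expR (s * x t).
  rewrite mulr_sumr; apply: eq_bigr => t _.
  have := q0 t; rewrite le_eqVlt => /predU1P[<-|qt]; first by rewrite !mul0r mulr0.
  rewrite mulrCA; congr (_ * _).
  by rewrite /powR gt_eqF ?qrho // -expRD /x mulrDr.
apply: (@le_lt_trans _ _ (\sum_t q t * (1 + s * x t + 2 * (s * B) ^+ 2))).
  apply: ler_sum => t _; apply: ler_wpM2l => //.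
  apply: (le_trans (expR_le_quadratic _)).
    apply: le_trans sB; apply: ler_wpM2l; first exact: ltW.
    by apply: le_trans (xB t); exact: ler_norm.
  rewrite lerD2l ler_pM2l // -[leLHS]real_normK ?num_real //.
  rewrite lerXn2r ?nnegrE // ?mulr_ge0 ?(ltW s0) ?(ltW B0) //.
  by rewrite normrM gtr0_norm // ler_wpM2l // ltW.
have -> : \sum_t q t * (1 + s * x t + 2 * (s * B) ^+ 2) = 1 - s * g + 2 * (s * B) ^+ 2.
  rewrite /g.
  transitivity (\sum_t (q t + (s * (q t * x t) + q t * (2 * (s * B) ^+ 2)))).
    by apply: eq_bigr => t _; ring.
  rewrite big_split big_split /= -mulr_sumr -mulr_suml q1; ring.
have : 4 * (s * B) ^+ 2 <= s * g.
  rewrite exprMn expr2 -!mulrA [4 * _]mulrCA ler_pM2l // [4 * _]mulrCA.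
  rewrite -ler_pdivlMr; last by rewrite mulr_gt0 // exprn_gt0.
  by rewrite /s ge_min lexx orbT.
have : 0 < s * g by rewrite mulr_gt0.
lra.
Qed.

Section Info.
Variables (R : realType) (L : finType) (S : L -> finType) (p : forall l, S l -> R).
Hypothesis pD : forall l, is_dist (@p l).
Variables (B : finType) (V : {dffun forall l, S l} -> B -> R).
Hypothesis VD : forall z, is_dist (V z).

Definition smear (G : {set L}) (z : {dffun forall l, S l}) (b : B) : R :=
  resample p G (V^~ b) z.

(** [smear G z] is the law of the output given the seeds outside [G]. For [G \subset G'] this is
    thus, in nats, the mutual information between the output and the seeds in [G' :\: G] given those
    outside [G']. *)
Definition info (G G' : {set L}) : R :=
  \sum_z \sum_b indep_law p z * V z b * ln (smear G z b / smear G' z b).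

Let V0 z b : 0 <= V z b. Proof. by case: (VD z). Qed.
Let p0 z : 0 <= indep_law p z. Proof. by case: (indep_law_dist pD). Qed.

Lemma smear_ge0 G z b : 0 <= smear G z b.
Proof. exact: (resample_ge0 pD). Qed.

Lemma smear_gt0 G z b : 0 < indep_law p z -> 0 < V z b -> 0 < smear G z b.
Proof. by move=> pz seed_channel; apply: (resample_gt0 pD). Qed.

Lemma weight_eq0 z b : 0 < indep_law p z * V z b \/ indep_law p z * V z b = 0.
Proof.
have := mulr_ge0 (p0 z) (V0 z b).
by rewrite le_eqVlt => /predU1P[<-|]; [right|left].
Qed.

Lemma weight_gt0 z b : 0 < indep_law p z * V z b -> 0 < indep_law p z /\ 0 < V z b.
Proof.
move=> pV; split; rewrite lt_def ?p0 ?V0 andbT; apply: contraTneq pV => ->;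
  by rewrite ?mul0r ?mulr0 ltxx.
Qed.

Lemma smear_dist G z : is_dist (smear G z).
Proof.
split=> [b|]; first exact: smear_ge0.
by apply: resample_sum => // z'; case: (VD z').
Qed.

Lemma info_chain G1 G2 G3 : info G1 G3 = info G1 G2 + info G2 G3.
Proof.
rewrite /info -big_split; apply: eq_bigr => z _; rewrite -big_split; apply: eq_bigr => b _ /=.
have [/weight_gt0[pz seed_channel]|->] := weight_eq0 z b; last by rewrite !mul0r addr0.
rewrite -mulrDr; congr (_ * _).
by rewrite !ln_div ?posrE ?smear_gt0 // addrA subrK.
Qed.

Lemma info_id G : info G G = 0.
Proof. by have := info_chain G G G; lra. Qed.

(** By [ln x <= x - 1] at the ratio of [smear G'] to [smear G], it suffices that the mean of this
    ratio is at most 1. *)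
Lemma info_ge0 (G G' : {set L}) : G \subset G' -> 0 <= info G G'.
Proof.
move=> GG'.
suff : 1 - \sum_z \sum_b indep_law p z * V z b * (smear G' z b / smear G z b) <= info G G'.
  apply: le_trans; rewrite subr_ge0 exchange_big /=.
  apply: (@le_trans _ _ (\sum_b \sum_z indep_law p z * smear G' z b)).
    apply: ler_sum => b _.
    under eq_bigr do rewrite -mulrA [V _ _ * _]mulrC.
    (* The ratio is untouched by [G], so under the mean [V] may be replaced by [smear G], which
       cancels the denominator. *)
    rewrite (@resample_expect _ _ _ _ pD G (V^~ b) (fun z => smear G' z b / smear G z b)); last first.
      move=> c a; congr (_ / _); last exact: resample_untouched.
      exact: (untouchedS GG' (@resample_untouched _ _ _ _ _ _)).
    apply: ler_sum => z _; apply: ler_wpM2l => //.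
    have [->|sG] := eqVneq (smear G z b) 0; first by rewrite invr0 mulr0 mul0r smear_ge0.
    by rewrite -mulrA mulVf // mulr1.
  rewrite exchange_big /=; under eq_bigr do rewrite -mulr_sumr.
  under eq_bigr => z _ do rewrite (proj2 (smear_dist G' z)) mulr1.
  by rewrite (proj2 (indep_law_dist pD)).
have <- : \sum_z \sum_b indep_law p z * V z b = 1.
  under eq_bigr => z _ do rewrite -mulr_sumr (proj2 (VD z)) mulr1.
  by rewrite (proj2 (indep_law_dist pD)).
rewrite /info -sumrB; apply: ler_sum => z _; rewrite -sumrB; apply: ler_sum => b _.
have [pV|->] := weight_eq0 z b; last by rewrite !mul0r subr0.
have [pz seed_channel] := weight_gt0 pV.
rewrite -[X in X - _]mulr1 -mulrBr ler_pM2l //.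
have sG := smear_gt0 G pz seed_channel; have sG' := smear_gt0 G' pz seed_channel.
have -> : smear G z b / smear G' z b = (smear G' z b / smear G z b)^-1 by rewrite invf_div.
rewrite lnV ?posrE ?divr_gt0 // lerNr opprB.
have := @le_ln1Dx R (smear G' z b / smear G z b - 1).
rewrite subrKC; apply; rewrite ltrBrDl subrr divr_gt0 //.
Qed.

Lemma info_mono (G E E' : {set L}) : E \subset E' -> info G E <= info G E'.
Proof. by move=> /info_ge0; rewrite (info_chain G E E') lerDl. Qed.

End Info.

(** * Conditional mutual information on the seed space *)

Lemma cond_mutual_infoE (R : realType) (T A B C : finType) (p : T -> R)
    (f : T -> A) (g : T -> B) (h : T -> C) :
  cond_mutual_info p f g h =
  \sum_t p t * log2 (pr p (fun t => (f t, g t, h t)) (f t, g t, h t) * pr p h (h t) /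
    (pr p (fun t => (f t, h t)) (f t, h t) * pr p (fun t => (g t, h t)) (g t, h t))).
Proof.
rewrite /cond_mutual_info.
under eq_bigr do rewrite pair_big /=.
rewrite pair_big /= [RHS](partition_big (fun t => (f t, (g t, h t))) xpredT) //=.
apply: eq_bigr => -[a [b c]] _ /=; rewrite [X in X * _]/pr mulr_suml.
apply: eq_big => t; first by rewrite !xpair_eqE andbA.
by move=> /eqP[<- <- <-].
Qed.

Section SeedInfo.
Variables (R : realType) (L : finType) (S : L -> finType) (p : forall l, S l -> R).
Hypothesis pD : forall l, is_dist (@p l).
Notation seeds := {dffun forall l, S l}.
Variables (Y : finType) (V : seeds -> Y -> R).
Hypothesis VD : forall z, is_dist (V z).
Variables (T : finType) (law : T -> R) (m : seeds -> Y -> T).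
Hypothesis lawE : forall phi : T -> R,
  \sum_t law t * phi t = \sum_z \sum_y indep_law p z * V z y * phi (m z y).
Variables (B : finType) (g : T -> B) (gY : Y -> B).
Hypothesis gE : forall z y, g (m z y) = gY y.

Definition output_law (z : seeds) (b : B) : R := \sum_(y | gY y == b) V z y.

Lemma output_law_dist z : is_dist (output_law z).
Proof.
split=> [b|]; first by apply: sumr_ge0 => y _; case: (VD z).
by case: (VD z) => _ <-; rewrite [RHS](partition_big gY xpredT).
Qed.

Lemma output_law_sum z (phi : B -> R) :
  \sum_b output_law z b * phi b = \sum_y V z y * phi (gY y).
Proof.
rewrite [RHS](partition_big gY xpredT) //=; apply: eq_bigr => b _.
by rewrite mulr_suml; apply: eq_bigr => y /eqP->.
Qed.

Lemma prE (A : finType) (f : T -> A) a :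
  pr law f a = \sum_z \sum_y indep_law p z * V z y * (f (m z y) == a)%:R.
Proof.
rewrite -(lawE (fun t => (f t == a)%:R)) /pr big_mkcond; apply: eq_bigr => t _.
by case: (_ == a); rewrite ?mulr1 ?mulr0.
Qed.

(** What lets [H] stand for all the seeds outside [G] in a conditioning. [H] may forget parts of
    them, such as the values of a strategy at arguments that do not occur. *)
Definition determines (C : finType) (H : seeds -> C) (G : {set L}) : Prop :=
  untouched G H /\ forall c z z', H z = H z' ->
    output_law (mix G c z) = output_law (mix G c z').

Variables (C : finType) (h : T -> C) (H : seeds -> C) (G : {set L}).
Hypothesis hE : forall z y, h (m z y) = H z.
Hypothesis HG : determines H G.

Lemma pr_seed c : pr law h c = \sum_z indep_law p z * (H z == c)%:R.
Proof.
rewrite prE; apply: eq_bigr => z _; under eq_bigr => y _ do rewrite hE -mulrA.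
by rewrite -mulr_sumr -mulr_suml; case: (VD z) => _ ->; rewrite mul1r.
Qed.

(** Redrawing [G] keeps the event [H z = H z0], and on this event [determines] allows [z0] in place
    of [z]. Hence [smear G z0] is the law of the output given the event. *)
Lemma pr_output b z0 :
  pr law (fun t => (g t, h t)) (b, H z0) =
  smear p output_law G z0 b * pr law h (H z0).
Proof.
rewrite pr_seed mulr_sumr prE.
transitivity (\sum_z indep_law p z * ((H z == H z0)%:R * output_law z b)).
  apply: eq_bigr => z _; rewrite /output_law [in RHS]big_mkcond !mulr_sumr.
  apply: eq_bigr => y _; rewrite xpair_eqE gE hE.
  by case: (_ == b); case: (_ == H z0); rewrite ?mulr1 ?mul1r ?mulr0 ?mul0r ?mulr0.
rewrite (@resample_expect _ _ _ _ pD G (fun z => output_law z b) (fun z => (H z == H z0)%:R)); last first.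
  by move=> c a; rewrite (proj1 HG).
apply: eq_bigr => z _; rewrite mulrCA [RHS]mulrC; rewrite -[RHS]mulrA.
rewrite mulrCA; congr (_ * _).
have [zz0|_] := eqVneq (H z) (H z0); last by rewrite !mul0r.
rewrite !mul1r; apply: eq_bigr => c _; congr (_ * _).
by rewrite (proj2 HG c _ _ zz0).
Qed.

Lemma pr_seed_gt0 z : 0 < indep_law p z -> 0 < pr law h (H z).
Proof.
move=> pz; rewrite pr_seed (bigD1 z) //= eqxx mulr1 ltr_pwDl //.
by apply: sumr_ge0 => z' _; rewrite mulr_ge0 //; case: (indep_law_dist pD).
Qed.

End SeedInfo.

(** The logarithm in the information compares the laws of the output given [(F, H)] and given [H];
    by [pr_output] both are smears. *)
Lemma cond_mutual_info_seeds (R : realType) (L : finType) (S : L -> finType)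
    (p : forall l, S l -> R) (pD : forall l, is_dist (@p l))
    (Y : finType) (V : {dffun forall l, S l} -> Y -> R) (VD : forall z, is_dist (V z))
    (T : finType) (law : T -> R) (m : {dffun forall l, S l} -> Y -> T)
    (lawE : forall phi : T -> R,
      \sum_t law t * phi t = \sum_z \sum_y indep_law p z * V z y * phi (m z y))
    (A B C : finType) (f : T -> A) (g : T -> B) (h : T -> C)
    (F : {dffun forall l, S l} -> A) (gY : Y -> B) (H : {dffun forall l, S l} -> C)
    (G G' : {set L}) :
  (forall z y, f (m z y) = F z) -> (forall z y, g (m z y) = gY y) ->
  (forall z y, h (m z y) = H z) ->
  determines V gY (fun z => (F z, H z)) G -> determines V gY H G' ->
  cond_mutual_info law f g h = info p (output_law V gY) G G' / ln 2.
Proof.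
move=> fE gE hE dF dH.
rewrite cond_mutual_infoE lawE /info mulr_suml; apply: eq_bigr => z _.
under [X in _ = X / _]eq_bigr do rewrite -mulrA.
rewrite -mulr_sumr.
rewrite (output_law_sum V gY z (fun b =>
  ln (smear p (output_law V gY) G z b / smear p (output_law V gY) G' z b))).
rewrite -mulrA mulr_suml mulr_sumr; apply: eq_bigr => y _.
rewrite -!mulrA; have := proj1 (indep_law_dist pD) z; rewrite le_eqVlt => /predU1P[<-|pz].
  by rewrite !mul0r.
congr (_ * (_ * _)); rewrite /log2 fE gE hE; congr (ln _ / _).
have -> : pr law (fun t => (f t, g t, h t)) (F z, gY y, H z) =
    pr law (fun t => (g t, (f t, h t))) (gY y, (F z, H z)).
  by apply: eq_bigl => t; rewrite !xpair_eqE; case: (f t == _); case: (g t == _).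
have fhE z' y' : (fun t => (f t, h t)) (m z' y') = (F z', H z') by rewrite fE hE.
rewrite (pr_output (h := fun t => (f t, h t)) (H := fun z => (F z, H z)) pD VD lawE gE fhE dF) (pr_output pD VD lawE gE hE dH).
have := pr_seed_gt0 pD VD lawE hE pz; have := pr_seed_gt0 (h := fun t => (f t, h t)) (H := fun z => (F z, H z)) pD VD lawE fhE pz.
move=> /gt_eqF/negbT fh0 /gt_eqF/negbT h0.
set u := smear _ _ _ _ _; set v := smear _ _ _ _ _.
(* With a vanishing denominator both quotients are 0. *)
have [->|v0] := eqVneq v 0; first by rewrite !(mul0r, mulr0) invr0 !mulr0.
field; by rewrite fh0 h0 v0.
Qed.

(** * Seeds for the coding distribution *)

Lemma prod_bool (R : comPzSemiRingType) (I : finType) (b : pred I) :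
  \prod_i (b i)%:R = [forall i, b i]%:R :> R.
Proof.
have [/forallP bT|/forallPn[i bi]] := boolP [forall i, b i].
  by rewrite big1 // => i _; rewrite bT.
by rewrite (bigD1 i) //= (negbTE bi) mul0r.
Qed.

Lemma indep_law_marginal (R : realType) (L : finType) (S : L -> finType)
    (p : forall l, S l -> R) (l0 : L) (b : S l0) :
  (forall l, is_dist (@p l)) ->
  \sum_(z : {dffun forall l, S l}) indep_law p z * (z l0 == b)%:R = p l0 b.
Proof.
move=> pD.
(* Tags allow [z l] to be compared with [b] although the types agree only at [l0]. *)
transitivity (\sum_(z : {dffun forall l, S l}) \prod_l
   (p l (z l) * (if l == l0 then (Tagged S (z l) == Tagged S b)%:R else 1))).
  apply: eq_bigr => z _; rewrite big_split /= -big_mkcond big_pred1_eq.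
  by rewrite eq_Tagged.
rewrite -(prod_sum_dffun (fun l s => p l s *
   (if l == l0 then (Tagged S s == Tagged S b)%:R else 1))).
rewrite (bigD1 l0) //= eqxx [X in _ * X]big1 ?mulr1.
  by rewrite -[RHS]sum_pick; apply: eq_bigr => s _; rewrite eq_Tagged.
move=> l /negbTE ->; under eq_bigr do rewrite mulr1.
by case: (pD l).
Qed.

Section Channel.
Variables (R : realType) (k : cell -> nat) (C : mac_ic_mac R k).

Lemma channel_law_dist (x : inputs C) : is_dist (channel_law x).
Proof.
apply: (@indep_law_dist _ _ _ (fun i => ch_law (x i) (x (~~ i) (user1 k (~~ i))))).
by move=> i; exact: ch_law_dist.
Qed.

Lemma channel_law_output (x : inputs C) i (b : ch_out C i) :
  \sum_(y : outputs C | y i == b) channel_law x y =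
  ch_law (x i) (x (~~ i) (user1 k (~~ i))) b.
Proof.
rewrite -(@indep_law_marginal _ _ _
  (fun i => ch_law (x i) (x (~~ i) (user1 k (~~ i))))); last first.
  by move=> l; exact: ch_law_dist.
rewrite big_mkcond; apply: eq_bigr => y _.
by case: (_ == b); rewrite ?mulr1 ?mulr0.
Qed.

Variables (Q : finType) (U : cell -> finType) (P : coding C Q U -> R).
Variables (pQ : Q -> R) (pU : forall i, Q -> U i -> R).
Variable (pX : forall i (j : user k i), Q * option (U i) -> ch_in C j -> R).

Definition strategy_arg i (j : user k i) (q : Q) (u : U i) : Q * option (U i) :=
  (q, if j == user1 k i then Some u else None).

Hypothesis pQD : is_dist pQ.
Hypothesis pUD : forall i q, is_dist (@pU i q).
Hypothesis pXD : forall i (j : user k i) a, is_dist (@pX i j a).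
Hypothesis PE : forall q (u : aux U) (x : inputs C), P (q, u, x) =
  pQ q * \prod_i (pU q (u i) * \prod_(j : user k i) pX (strategy_arg j q (u i)) (x i j)).

Definition slot : finType := (unit + (cell + {i : cell & user k i}))%type.

(* Shannon strategies: the seed of a user is a whole function of the symbols it
   is superposed on, which makes all the seeds independent. *)
Definition seed (l : slot) : finType :=
  match l with
  | inl _ => Q
  | inr (inl i) => {ffun Q -> U i}
  | inr (inr d) => {ffun Q * option (U (tag d)) -> ch_in C (tagged d)}
  end.

Definition seed_law (l : slot) : seed l -> R :=
  match l return seed l -> R with
  | inl _ => pQ
  | inr (inl i) => fun_law (@pU i)
  | inr (inr d) => fun_law (@pX (tag d) (tagged d))
  end.

Lemma seed_law_dist l : is_dist (@seed_law l).
Proof. by case: l => [[]|[i|d]] //=; exact: fun_law_dist. Qed.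

Notation seeds := {dffun forall l, seed l}.

Definition slotX i (j : user k i) : slot := inr (inr (Tagged (user k) j)).

Definition zQ (z : seeds) : Q := z (inl tt).
Definition zU i (z : seeds) : U i := (z (inr (inl i)) : {ffun Q -> U i}) (zQ z).
Definition zX i (j : user k i) (z : seeds) : ch_in C j :=
  (z (slotX j) : {ffun Q * option (U i) -> ch_in C j}) (strategy_arg j (zQ z) (zU i z)).

Definition letter (z : seeds) : coding C Q U :=
  (zQ z, [ffun i => zU i z] : aux U,
   [ffun i => [ffun j => zX j z] : cell_input C i] : inputs C).

Lemma letter_law (w : coding C Q U) :
  \sum_z indep_law seed_law z * (letter z == w)%:R = P w.
Proof.
case: w => -[q u] x.
(* Once [q] and [u] are prescribed, the event says that each seed, read at known arguments, has the
   right value; this factors over the slots. *)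
pose ok (l : slot) : seed l -> bool :=
  match l return seed l -> bool with
  | inl _ => fun s => s == q
  | inr (inl i) => fun s : {ffun Q -> U i} => s q == u i
  | inr (inr d) => fun s : {ffun Q * option (U (tag d)) -> ch_in C (tagged d)} =>
       s (strategy_arg (tagged d) q (u (tag d))) == x (tag d) (tagged d)
  end.
transitivity (\sum_(z : seeds) \prod_l (seed_law (z l) * (ok l (z l))%:R)).
  apply: eq_bigr => z _; rewrite big_split /= prod_bool; congr (_ * (nat_of_bool _)%:R).
  apply/eqP/forallP => [[zq zu zx] [[]|[i|[i j]]] /=|okz].
  - exact/eqP.
  - by rewrite -zq -zu ffunE.
  - by rewrite -zq -zu -zx !ffunE.
  have zq : zQ z = q by apply/eqP; exact: (okz (inl tt)).
  have zu i : zU i z = u i by apply/eqP; rewrite /zU zq; exact: (okz (inr (inl i))).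
  rewrite /letter zq; congr (_, _, _); first by apply/ffunP => i; rewrite !ffunE zu.
  apply/ffunP => i; rewrite ffunE; apply/ffunP => j; rewrite ffunE.
  by apply/eqP; rewrite /zX zq zu; exact: (okz (slotX j)).
rewrite -(prod_sum_dffun (fun l s => seed_law s * (ok l s)%:R)).
rewrite !big_sumType /= big_const card_unit /= mulr1 sum_pick PE; congr (_ * _).
rewrite big_split /=; congr (_ * _).
  by apply: eq_bigr => i _; rewrite fun_law_eval.
rewrite sig_big_dep /=; apply: eq_big => // d _.
by rewrite fun_law_eval.
Qed.

Lemma letter_expect (phi : coding C Q U -> R) :
  \sum_w P w * phi w = \sum_z indep_law seed_law z * phi (letter z).
Proof.
under eq_bigr => w _ do rewrite -letter_law mulr_suml.
rewrite exchange_big /=; apply: eq_bigr => z _.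
rewrite (bigD1 (letter z)) //= eqxx mulr1 big1 ?addr0 // => w.
by rewrite eq_sym => /negbTE ->; rewrite mulr0 mul0r.
Qed.

Definition seed_channel (z : seeds) : outputs C -> R := channel_law (letter z).2.

Lemma seed_channel_dist z : is_dist (seed_channel z).
Proof. exact: channel_law_dist. Qed.

Lemma joint_expect (phi : outcome C Q U -> R) :
  \sum_t joint_dist P t * phi t =
  \sum_z \sum_y indep_law seed_law z * seed_channel z y * phi (letter z, y).
Proof.
transitivity (\sum_w P w * \sum_y channel_law w.2 y * phi (w, y)).
  under [RHS]eq_bigr do rewrite mulr_sumr.
  rewrite pair_big; apply: eq_bigr => -[w y] _ /=.
  by rewrite mulrA.
rewrite letter_expect; apply: eq_bigr => z _; rewrite mulr_sumr.
by apply: eq_bigr => y _; rewrite mulrA.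
Qed.

(* The seeds redrawn when receiver i averages over wrong users J of its own cell,
   over U_i if [bu], and over U_i' if [bu'].  The users of the other cell are
   noise given U_i', hence always redrawn. *)
Definition refresh i (J : {set user k i}) (bu bu' : bool) : {set slot} :=
  [set l : slot | match l with
     | inl _ => false
     | inr (inl i0) => if i0 == i then bu else bu'
     | inr (inr d) => if tag d == i then d \in [set Tagged (user k) j | j in J] else true
     end].

Lemma refresh_own i (J : {set user k i}) bu bu' j :
  (slotX j \in refresh J bu bu') = (j \in J).
Proof.
rewrite !inE /= eqxx mem_imset // => a b /eqP.
by rewrite eq_Tagged => /eqP.
Qed.

Lemma refresh_other i (J : {set user k i}) bu bu' (j : user k (~~ i)) :
  slotX j \in refresh J bu bu'.
Proof. by rewrite !inE /=; case: i J j. Qed.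

Lemma zQ_mix (G : {set slot}) (c z : seeds) : inl tt \notin G -> zQ (mix G c z) = zQ z.
Proof. by move=> /negbTE G0; rewrite /zQ ffunE G0. Qed.

Lemma refresh_zQ i (J : {set user k i}) bu bu' c z :
  zQ (mix (refresh J bu bu') c z) = zQ z.
Proof. by rewrite zQ_mix // inE. Qed.

Lemma refresh_zU i (J : {set user k i}) bu bu' i0 c z :
  zU i0 (mix (refresh J bu bu') c z) =
  if (if i0 == i then bu else bu') then (c (inr (inl i0)) : {ffun Q -> U i0}) (zQ z)
  else zU i0 z.
Proof. by rewrite /zU refresh_zQ ffunE inE; case: ifP. Qed.

Lemma refresh_zX i (J : {set user k i}) bu bu' i0 (j : user k i0) c z :
  zX j (mix (refresh J bu bu') c z) =
  ((if slotX j \in refresh J bu bu' then c (slotX j) else z (slotX j))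
    : {ffun Q * option (U i0) -> ch_in C j})
    (strategy_arg j (zQ z) (zU i0 (mix (refresh J bu bu') c z))).
Proof. by rewrite /zX refresh_zQ ffunE. Qed.

Lemma refresh_zX_notin i (J : {set user k i}) (bu bu' : bool) (j : user k i) c z :
  (bu -> user1 k i \in J) -> j \notin J ->
  zX j (mix (refresh J bu bu') c z) = zX j z.
Proof.
move=> buJ jJ; rewrite refresh_zX refresh_own (negbTE jJ) /zX; congr (_ _).
rewrite /strategy_arg; case: eqP => // ju; congr (_, Some _).
rewrite refresh_zU eqxx; case: bu buJ => // /(_ isT).
by rewrite -ju (negbTE jJ).
Qed.

Notation out i := (output_law seed_channel (fun y : outputs C => y i)).

Lemma output_lawE i z b : out i z b =
  ch_law [ffun j => zX j z] (zX (user1 k (~~ i)) z) b.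
Proof.
by rewrite /output_law channel_law_output /letter /= !ffunE.
Qed.

(** The strategy of user i'.1, the only interferer, is always redrawn, so that beyond [Q] only
    [U_i'] matters from the other cell. [U_i] matters only through a redrawn strategy of user i.1;
    when that user is outside [J], its input is known instead. *)
Lemma refresh_determines i (J : {set user k i}) (bu bu' : bool) (T : finType) (H : seeds -> T) :
  (bu -> user1 k i \in J) ->
  untouched (refresh J bu bu') H ->
  (forall z z', H z = H z' ->
    [/\ zQ z = zQ z', forall j, j \notin J -> zX j z = zX j z',
       ~~ bu -> user1 k i \in J -> zU i z = zU i z' &
       ~~ bu' -> zU (~~ i) z = zU (~~ i) z']) ->
  determines seed_channel (fun y : outputs C => y i) H (refresh J bu bu').
Proof.
move=> buJ HG Hz; split=> // c z z' /Hz[zq zx zu zu'] {HG Hz}.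
have zu'E : zU (~~ i) (mix (refresh J bu bu') c z) = zU (~~ i) (mix (refresh J bu bu') c z').
  rewrite !refresh_zU (_ : (~~ i == i) = false); last by case: (i).
  by case: bu' zu' => [_|->] //; rewrite zq.
apply/funext => b; rewrite !output_lawE; congr (ch_law _ _ b).
  apply/ffunP => j; rewrite !ffunE.
  have [jJ|jJ] := boolP (j \in J); last by rewrite !refresh_zX_notin // zx.
  rewrite !refresh_zX refresh_own jJ zq; congr (_ _).
  rewrite /strategy_arg; case: eqP => // ju; congr (_, Some _).
  rewrite !refresh_zU eqxx; case: bu {buJ zu'E} zu => [_|zu]; first by rewrite zq.
  by apply: zu => //; rewrite -ju.
by rewrite !refresh_zX refresh_other zq zu'E.
Qed.

(** In bits, and relative to a baseline that redraws just the users of the other cell: given [U_i']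
    they are noise even for the correct message. *)
Definition refresh_info i (J : {set user k i}) (bu bu' : bool) : R :=
  info seed_law (out i) (refresh (finset.set0 : {set user k i}) false false)
    (refresh J bu bu') / ln 2.

Lemma cond_mutual_info_refresh i (J : {set user k i}) (bu bu' : bool) (A B : finType)
    (f : outcome C Q U -> A) (h : outcome C Q U -> B) (F : seeds -> A) (H : seeds -> B) :
  (forall z y, f (letter z, y) = F z) -> (forall z y, h (letter z, y) = H z) ->
  (bu -> user1 k i \in J) ->
  untouched (refresh J bu bu') H ->
  untouched (refresh (finset.set0 : {set user k i}) false false) F ->
  (forall z z', H z = H z' ->
    [/\ zQ z = zQ z', forall j, j \notin J -> zX j z = zX j z',
       ~~ bu -> user1 k i \in J -> zU i z = zU i z' &
       ~~ bu' -> zU (~~ i) z = zU (~~ i) z']) ->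
  (forall z z', F z = F z' -> H z = H z' ->
    (forall j, zX (j : user k i) z = zX j z') /\ zU (~~ i) z = zU (~~ i) z') ->
  cond_mutual_info (joint_dist P) f (fun w => rvY i w) h = refresh_info J bu bu'.
Proof.
move=> fE hE buJ HG F0 HJ FHJ.
apply: (@cond_mutual_info_seeds _ _ _ _ seed_law_dist _ _ seed_channel_dist _ _ (fun z y => (letter z, y))
  joint_expect _ _ _ f (fun w => rvY i w) h F _ H) => //.
- apply: refresh_determines => //.
    move=> c z; congr (_, _); first exact: F0.
    apply: (untouchedS _ HG); apply/fintype.subsetP => -[[]|[i0|d]]; rewrite !inE ?if_same //.
    by case: ifP => // _ /imsetP[j]; rewrite inE.
  move=> z z' [Fz Hz]; have [zx zu] := FHJ _ _ Fz Hz; have [zq _ _ _] := HJ _ _ Hz.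
  by split=> //; rewrite inE.
- exact: refresh_determines.
Qed.

Let XS i (S : {set user k i}) (z : seeds) :=
  [ffun j : {j : user k i | j \in S} => (letter z).2 i (val j)]
  : {dffun forall j : {j : user k i | j \in S}, ch_in C (val j)}.

Lemma XS_eq i (S : {set user k i}) z z' :
  XS S z = XS S z' <-> forall j, j \in S -> zX j z = zX j z'.
Proof.
split=> [/ffunP zz' j jS|zz'].
  by have := zz' (exist _ j jS); rewrite !ffunE.
by apply/ffunP => -[j jS]; rewrite !ffunE /= zz'.
Qed.

Lemma XS_untouched i (S J : {set user k i}) (bu bu' : bool) :
  (bu -> user1 k i \in J) -> [disjoint S & J] ->
  untouched (refresh J bu bu') (XS S).
Proof.
move=> buJ SJ c z; apply/XS_eq => j jS; apply: refresh_zX_notin => //.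
by rewrite (disjointFr SJ jS).
Qed.

Lemma zU_untouched i (J : {set user k i}) bu bu' i0 :
  (if i0 == i then bu else bu') = false -> untouched (refresh J bu bu') (zU i0).
Proof. by move=> b0 c z; rewrite refresh_zU b0. Qed.

Lemma letterU i z : (letter z).1.2 i = zU i z.
Proof. by rewrite ffunE. Qed.

Let other i : (~~ i == i) = false. Proof. by case: i. Qed.

Lemma infoAE i (S : {set user k i}) : infoA P S = refresh_info S false false.
Proof.
apply: (cond_mutual_info_refresh (F := XS S)
  (H := fun z => (XS (~: S) z, zU i z, zU (~~ i) z, zQ z))) => //.
- by move=> z y; rewrite /rvU !letterU.
- move=> c z; rewrite refresh_zQ !zU_untouched ?eqxx ?other // XS_untouched //.
  by rewrite -finset.setI_eq0 finset.setIC finset.setICr.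
- by apply: XS_untouched => //; rewrite -finset.setI_eq0 finset.setI0.
- move=> z z' [/XS_eq zx zu zu' zq]; split=> // j jS; apply: zx.
  by rewrite inE.
- move=> z z' /XS_eq zx [/XS_eq zx' zu zu' zq]; split=> // j.
  by have [/zx|jS] := boolP (j \in S); last by apply: zx'; rewrite inE.
Qed.

(** [U_i] is not conditioned on here. If i.1 is in [S], it is redrawn together with the input of
    i.1; otherwise that input is given, [U_i] has no further influence on the output, and it can
    stay fixed. *)
Lemma infoBE i (S : {set user k i}) : infoB P S = refresh_info S (user1 k i \in S) false.
Proof.
apply: (cond_mutual_info_refresh (F := XS S)
  (H := fun z => (XS (~: S) z, zU (~~ i) z, zQ z))) => //.
- by move=> z y; rewrite /rvU !letterU.
- move=> c z; rewrite refresh_zQ !zU_untouched ?eqxx ?other // XS_untouched //.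
  by rewrite -finset.setI_eq0 finset.setIC finset.setICr.
- by apply: XS_untouched => //; rewrite -finset.setI_eq0 finset.setI0.
- move=> z z' [/XS_eq zx zu' zq]; split=> // [j jS|/negbTE->//]; apply: zx.
  by rewrite inE.
- move=> z z' /XS_eq zx [/XS_eq zx' zu' zq]; split=> // j.
  by have [/zx|jS] := boolP (j \in S); last by apply: zx'; rewrite inE.
Qed.

Lemma infoEE i (S : {set user k i}) : infoE P S = refresh_info S false true.
Proof.
apply: (cond_mutual_info_refresh (F := fun z => (XS S z, zU (~~ i) z))
  (H := fun z => (XS (~: S) z, zU i z, zQ z))) => //.
- by move=> z y; rewrite /rvU !letterU.
- by move=> z y; rewrite /rvU !letterU.
- move=> c z; rewrite refresh_zQ !zU_untouched ?eqxx ?other // XS_untouched //.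
  by rewrite -finset.setI_eq0 finset.setIC finset.setICr.
- move=> c z; rewrite zU_untouched ?other //.
  by rewrite XS_untouched //; rewrite -finset.setI_eq0 finset.setI0.
- move=> z z' [/XS_eq zx zu zq]; split=> // j jS; apply: zx.
  by rewrite inE.
- move=> z z' [/XS_eq zx zu'] [/XS_eq zx' zu zq]; split=> // j.
  by have [/zx|jS] := boolP (j \in S); last by apply: zx'; rewrite inE.
Qed.

Lemma infoGE i (S : {set user k i}) : infoG P S = refresh_info S (user1 k i \in S) true.
Proof.
apply: (cond_mutual_info_refresh (F := fun z => (XS S z, zU (~~ i) z))
  (H := fun z => (XS (~: S) z, zQ z))) => //.
- by move=> z y; rewrite /rvU !letterU.
- move=> c z; rewrite refresh_zQ XS_untouched //.
  by rewrite -finset.setI_eq0 finset.setIC finset.setICr.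
- move=> c z; rewrite zU_untouched ?other //.
  by rewrite XS_untouched //; rewrite -finset.setI_eq0 finset.setI0.
- move=> z z' [/XS_eq zx zq]; split=> // [j jS|/negbTE->//]; apply: zx.
  by rewrite inE.
- move=> z z' [/XS_eq zx zu'] [/XS_eq zx' zq]; split=> // j.
  by have [/zx|jS] := boolP (j \in S); last by apply: zx'; rewrite inE.
Qed.

Lemma refresh_info_mono i (J J' : {set user k i}) (bu bu' cu cu' : bool) :
  J \subset J' -> (bu ==> cu) -> (bu' ==> cu') -> refresh_info J bu bu' <= refresh_info J' cu cu'.
Proof.
move=> /fintype.subsetP JJ' bc bc'.
apply: ler_wpM2r; first by rewrite invr_ge0 ln_ge0 // ler1n.
apply: (info_mono seed_law_dist).
  by move=> z; apply: output_law_dist; exact: seed_channel_dist.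
apply/fintype.subsetP => -[[]|[i0|d]]; rewrite !inE //.
  by case: ifP => _; [case: bu bc|case: bu' bc'] => //= ->.
by case: ifP => // _ /imsetP[j /JJ' jJ ->]; rewrite imset_f.
Qed.

Lemma refresh_info0 i : refresh_info (finset.set0 : {set user k i}) false false = 0.
Proof.
rewrite /refresh_info info_id ?mul0r //; first exact: seed_law_dist.
by move=> z; apply: output_law_dist; exact: seed_channel_dist.
Qed.

End Channel.

(** * Rate splitting *)

(** The law of [U_i] and [X_i.1] given [q] is split into a marginal and a conditional law, so that
    every user has a kernel from which its strategy can be drawn. *)
Lemma coding_kernels (R : realType) (k : cell -> nat) (C : mac_ic_mac R k)
    (Q : finType) (U : cell -> finType) (P : coding C Q U -> R) :
  coding_dist P ->
  exists (pQ : Q -> R) (pU : forall i, Q -> U i -> R)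
    (pX : forall i (j : user k i), Q * option (U i) -> ch_in C j -> R),
  [/\ is_dist pQ, forall i q, is_dist (@pU i q),
      forall i (j : user k i) a, is_dist (@pX i j a) &
      forall q (u : aux U) (x : inputs C), P (q, u, x) =
        pQ q * \prod_i (pU i q (u i) *
          \prod_(j : user k i) pX i j (strategy_arg j q (u i)) (x i j))].
Proof.
move=> [pQ [pUX [pX [pQD pUXD pXD PE]]]].
pose pU i q u := \sum_x pUX i q (u, x).
have pUD i q : is_dist (pU i q).
  split=> [u|]; first by apply: sumr_ge0 => x _; case: (pUXD i q).
  rewrite /pU pair_big /=; case: (pUXD i q) => _ <-.
  by apply: eq_bigr => -[].
pose mX i q x := \sum_u pUX i q (u, x).
have mXD i q : is_dist (mX i q).
  split=> [u|]; first by apply: sumr_ge0 => x _; case: (pUXD i q).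
  rewrite /mX exchange_big pair_big /=; case: (pUXD i q) => _ <-.
  by apply: eq_bigr => -[].
have kerX i (j : user k i) : exists K : Q * option (U i) -> ch_in C j -> R,
  [/\ forall a, is_dist (K a), j != user1 k i -> forall a, K a = pX i j a.1 &
      forall (x : cell_input C i) q u, j = user1 k i ->
        pU i q u * K (q, Some u) (x j) = pUX i q (u, x (user1 k i))].
  have [->|ju] := eqVneq j (user1 k i); last first.
    exists (fun a => pX i j a.1); split=> // [a|x q u ju']; first exact: pXD.
    by rewrite ju' eqxx in ju.
  (* Where the conditional law is undefined, and at the argument [None], the marginal [mX] is a
     default that keeps the kernel a distribution. *)
  exists (fun a x => match a.2 with
    | Some u => if pU i a.1 u == 0 then mX i a.1 x else pUX i a.1 (u, x) / pU i a.1 u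
    | None => mX i a.1 x end); split=> // [[q [u|]] /=|x q u _ /=].
  - have [_|u0] := eqVneq (pU i q u) 0; first exact: mXD.
    split=> [x|]; last by rewrite -mulr_suml divff.
    by apply: divr_ge0; [case: (pUXD i q)|case: (pUD i q)].
  - exact: mXD.
  have [u0|u0] := eqVneq; last by rewrite mulrC divfK.
  rewrite u0 mul0r; apply/esym/eqP; rewrite eq_le (proj1 (pUXD i q)) andbT -u0.
  rewrite /pU (bigD1 (x (user1 k i))) //= lerDl.
  by apply: sumr_ge0 => x' _; case: (pUXD i q).
pose K i j := sval (cid (kerX i j)).
exists pQ, pU, K; split=> // [i j a|q u x].
  by rewrite /K; case: cid => ? [].
rewrite PE; congr (_ * _); apply: eq_bigr => i _.
rewrite [in RHS](bigD1 (user1 k i)) //= mulrA; congr (_ * _).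
  by rewrite /strategy_arg eqxx /K; case: cid => /= f [_ _ fE]; rewrite fE.
apply: eq_bigr => j ju; rewrite /K; case: cid => /= f [_ fE _]; rewrite fE //.
Qed.

(** A system of difference constraints. The witnesses are its least solution: the lower bounds [l1]
    and [l2], each propagated once through the constraints on [s1 - s2] and [s2 - s1]. One round is
    enough since [r1 + r2 <= e1 + e2]; the other hypotheses keep the lower bounds below the upper
    ones. *)
Lemma difference_system (R : realFieldType) (r1 r2 a1 a2 e1 e2 g1 g2 : R) :
  0 <= r1 -> 0 <= r2 -> 0 <= a1 -> 0 <= a2 -> 0 <= e1 -> 0 <= e2 -> 0 <= g1 -> 0 <= g2 ->
  r1 <= a1 + g2 -> r2 <= a2 + g1 -> r1 <= e1 + g2 -> r2 <= e2 + g1 ->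
  r1 <= a1 + e2 -> r2 <= a2 + e1 -> r1 + r2 <= e1 + e2 ->
  r1 + r2 <= a1 + g1 + e2 -> r1 + r2 <= e1 + a2 + g2 ->
  exists s1 s2, [/\ 0 <= s1 <= r1, 0 <= s2 <= r2, s1 <= a1 /\ s2 <= a2,
    s1 + (r2 - s2) <= e1 /\ s2 + (r1 - s1) <= e2 & r2 - s2 <= g1 /\ r1 - s1 <= g2].
Proof.
move=> r10 r20 a10 a20 e10 e20 g10 g20 h1 h2 h3 h4 h5 h6 h7 h8 h9.
(* The maximum enters by its universal property, which leaves linear facts for [lra]. *)
have maxP (x y : R) : exists m, [/\ x <= m, y <= m & forall t, x <= t -> y <= t -> m <= t].
  exists (Num.max x y); rewrite !le_max !lexx orbT; split=> // t xt yt.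
  by rewrite ge_max xt yt.
have [l1 [l10 l1g l1u]] := maxP 0 (r1 - g2); have [l2 [l20 l2g l2u]] := maxP 0 (r2 - g1).
have [s1 [s1l s1e s1u]] := maxP l1 (l2 - (e2 - r1)).
have [s2 [s2l s2e s2u]] := maxP l2 (l1 - (e1 - r2)).
have l1r : l1 <= r1 by apply: l1u; lra.
have l2r : l2 <= r2 by apply: l2u; lra.
have l1a : l1 <= a1 by apply: l1u; lra.
have l2a : l2 <= a2 by apply: l2u; lra.
have l1r2 : l1 <= r2 + (e1 - r2) by apply: l1u; lra.
have l2r1 : l2 <= r1 + (e2 - r1) by apply: l2u; lra.
have l1a2 : l1 <= a2 + (e1 - r2) by apply: l1u; lra.
have l2a1 : l2 <= a1 + (e2 - r1) by apply: l2u; lra.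
exists s1, s2; split.
- by apply/andP; split; [lra|apply: s1u; lra].
- by apply/andP; split; [lra|apply: s2u; lra].
- by split; [apply: s1u; lra|apply: s2u; lra].
- have : s1 <= s2 + (e1 - r2) by apply: s1u; lra.
  have : s2 <= s1 + (e2 - r1) by apply: s2u; lra.
  by split; lra.
by split; lra.
Qed.

Lemma ex_minimizer (R : realType) (T : finType) (A : pred T) (F : T -> R) t0 :
  A t0 -> exists2 t, A t & forall t', A t' -> F t <= F t'.
Proof. by move=> At0; case: (arg_minP F At0) => t At tmin; exists t. Qed.

Section RateSplitting.
Variables (R : realType) (k : cell -> nat) (C : mac_ic_mac R k).
Variables (Q : finType) (U : cell -> finType) (P : coding C Q U -> R).

Hypothesis A0 : forall i (V : {set user k i}), 0 <= infoA P V.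
Hypothesis BA : forall i (V : {set user k i}), infoB P (V :\ user1 k i) <= infoA P V.
Hypothesis AE : forall i (V : {set user k i}), infoA P V <= infoE P V.
Hypothesis GE : forall i (V : {set user k i}), infoG P (V :\ user1 k i) <= infoE P V.
Hypothesis BG : forall i (W : {set user k i}), infoB P W <= infoG P W.

Lemma sum_rateD1 (r : rates R k) i (V : {set user k i}) : user1 k i \in V ->
  sum_rate r V = rate r (user1 k i) + sum_rate r (V :\ user1 k i).
Proof. by move=> uV; rewrite /sum_rate (big_setD1 (user1 k i)). Qed.

(* Fourier-Motzkin elimination of the private rates: [s i] is the private part
   of the rate of user i.1, the common part being the rest. *)
Lemma rate_splitting (r : rates R k) : inner_region P r ->
  exists s : cell -> R, forall i,
  [/\ 0 <= s i <= rate r (user1 k i),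
      forall V : {set user k i}, user1 k i \in V ->
        s i + sum_rate r (V :\ user1 k i) <= infoA P V,
      forall V : {set user k i}, user1 k i \in V ->
        s i + sum_rate r (V :\ user1 k i) + (rate r (user1 k (~~ i)) - s (~~ i)) <= infoE P V,
      forall W : {set user k i}, W != finset.set0 -> sum_rate r W <= infoB P W &
      forall W : {set user k i}, W != finset.set0 ->
        sum_rate r W + (rate r (user1 k (~~ i)) - s (~~ i)) <= infoG P W].
Proof.
move=> [r0 rP].
have u1 i : user1 k i \in [set user1 k i]%SET by rewrite inE.
have n1 i : [set user1 k i]%SET != finset.set0 by rewrite -card_gt0 cards1.
have rB i (W : {set user k i}) : W != finset.set0 -> sum_rate r W <= infoB P W.
  case: i W => W W0.
    by have [_ [_ [? _]]] := rP _ _ _ _ (u1 cell1) (n1 cell1) (u1 cell2) W0.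
  by have [? _] := rP _ _ _ _ (u1 cell1) W0 (u1 cell2) (n1 cell2).
have rA i (V : {set user k i}) : sum_rate r (V :\ user1 k i) <= infoA P V.
  have [->|V0] := eqVneq (V :\ user1 k i)%SET finset.set0.
    by rewrite /sum_rate big_set0.
  exact: le_trans (rB _ _ V0) (BA _).
have rE i (V : {set user k i}) : sum_rate r (V :\ user1 k i) <= infoE P V.
  exact: le_trans (rA _ _) (AE _).
have rG i (W : {set user k i}) : W != finset.set0 -> sum_rate r W <= infoG P W.
  by move=> /rB /le_trans; apply.
(* If [V] has no user besides i.1, this is the bound A + E on [V'] alone; otherwise it is the bound
   A + G on [V'] and [V :\ user1 k i], weakened by [GE]. *)
have EA i (V : {set user k i}) : user1 k i \in V ->
    forall V' : {set user k (~~ i)}, user1 k (~~ i) \in V' ->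
    rate r (user1 k (~~ i)) <= (infoA P V' - sum_rate r (V' :\ user1 k (~~ i))) +
       (infoE P V - sum_rate r (V :\ user1 k i)).
  move=> uV V' uV'.
  have [V0|V0] := eqVneq (V :\ user1 k i)%SET finset.set0.
    rewrite V0 /sum_rate big_set0 subr0 -/(sum_rate _ _).
    case: i V V' uV uV' V0 => V V' uV uV' _; rewrite /= in V' uV' *.
      have [_ [h _]] := rP _ _ _ _ uV' (n1 cell1) uV (n1 cell2).
      by move: h; rewrite (sum_rateD1 _ uV') /=; lra.
    have [_ [_ [_ [h _]]]] := rP _ _ _ _ uV (n1 cell1) uV' (n1 cell2).
    by move: h; rewrite (sum_rateD1 _ uV') /=; lra.
  have := GE V; move: V0; set W := (V :\ _)%SET => V0.
  case: i V V' uV uV' W V0 => V V' uV uV' W V0; rewrite /= in V' uV' *.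
    have [_ [_ [_ [_ [h _]]]]] := rP _ _ _ _ uV' (n1 cell1) (u1 cell2) V0.
    by move: h; rewrite (sum_rateD1 _ uV') /=; lra.
  have [_ [_ [_ [_ [_ [h _]]]]]] := rP _ _ _ _ (u1 cell1) V0 uV' (n1 cell2).
  by move: h; rewrite (sum_rateD1 _ uV') /=; lra.
(* Each family of constraints on the split is as strong as its member of least slack, which leaves
   one set per family and cell. *)
have exa i := ex_minimizer (A := fun V : {set user k i} => user1 k i \in V) (fun V => infoA P V - sum_rate r (V :\ user1 k i)) (u1 i).
have exe i := ex_minimizer (A := fun V : {set user k i} => user1 k i \in V) (fun V => infoE P V - sum_rate r (V :\ user1 k i)) (u1 i).
have exg i := ex_minimizer (A := fun W : {set user k i} => W != finset.set0) (fun W => infoG P W - sum_rate r W) (n1 i).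
have [Va1 ua1] := exa cell1; have [Va2 ua2] := exa cell2.
have [Ve1 ue1] := exe cell1; have [Ve2 ue2] := exe cell2.
have [Wg1 ng1] := exg cell1; have [Wg2 ng2] := exg cell2.
have := rG _ _ ng1; have := rG _ _ ng2.
have := rA _ Va1; have := rA _ Va2; have := rE _ Ve1; have := rE _ Ve2.
have := EA _ _ ue1 _ ua2; have := EA _ _ ue2 _ ua1.
have [_ [_ [_ [_ [h5 _]]]]] := rP _ _ _ _ ua1 (n1 cell1) (u1 cell2) ng2.
have [_ [_ [_ [_ [_ [h6 _]]]]]] := rP _ _ _ _ (u1 cell1) ng1 ua2 (n1 cell2).
have [_ [_ [_ [_ [_ [_ [h7 _]]]]]]] := rP _ _ _ _ ue1 ng1 ue2 ng2.
have [_ [_ [_ [_ [_ [_ [_ [h8 _]]]]]]]] := rP _ _ _ _ ua1 ng1 ue2 ng2.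
have [_ [_ [_ [_ [_ [_ [_ [_ h9]]]]]]]] := rP _ _ _ _ ue1 ng1 ua2 ng2.
(* The bound A + G is also taken at the minimizers of E, where [AE] turns it into a bound by E +
   G. *)
have [_ [_ [_ [_ [h5' _]]]]] := rP _ _ _ _ ue1 (n1 cell1) (u1 cell2) ng2.
have [_ [_ [_ [_ [_ [h6' _]]]]]] := rP _ _ _ _ (u1 cell1) ng1 ue2 (n1 cell2).
have := AE Ve1; have := AE Ve2.
have := r0 cell1 (user1 k cell1); have := r0 cell2 (user1 k cell2).
move: h5 h6 h7 h8 h9 h5' h6'.
rewrite (sum_rateD1 _ ua1) (sum_rateD1 _ ua2) (sum_rateD1 _ ue1) (sum_rateD1 _ ue2) /=.
set a1 := infoA P Va1; set a2 := infoA P Va2; set e1 := infoE P Ve1; set e2 := infoE P Ve2.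
set g1 := infoG P Wg1; set g2 := infoG P Wg2.
set ra1 := sum_rate r (Va1 :\ _); set ra2 := sum_rate r (Va2 :\ _).
set re1 := sum_rate r (Ve1 :\ _); set re2 := sum_rate r (Ve2 :\ _).
set rg1 := sum_rate r Wg1; set rg2 := sum_rate r Wg2.
set r1 := r.1 _ _; set r2 := r.2 _ _.
move=> h5 h6 h7 h8 h9 h5' h6' r20 r10 ae2 ae1 ea2 ea1 e20 e10 a20 a10 g20 g10.
move=> mg2 mg1 me2 me1 ma2 ma1.
have [s1 [s2 [s1r s2r [s1a s2a] [s1e s2e] [s2g s1g]]]] :
    exists s1 s2, [/\ 0 <= s1 <= r1, 0 <= s2 <= r2, s1 <= a1 - ra1 /\ s2 <= a2 - ra2,
    s1 + (r2 - s2) <= e1 - re1 /\ s2 + (r1 - s1) <= e2 - re2 &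
    r2 - s2 <= g1 - rg1 /\ r1 - s1 <= g2 - rg2].
  by apply: difference_system; lra.
exists (fun i => if i then s2 else s1) => -[]; (split; [exact: s2r || exact: s1r| | |exact: rB|]).
- by move=> V uV; have := ma2 V uV; rewrite /=; lra.
- by move=> V uV; have := me2 V uV; rewrite /= -/r1; lra.
- by move=> W W0; have := mg2 W W0; rewrite /= -/r1; lra.
- by move=> V uV; have := ma1 V uV; rewrite /=; lra.
- by move=> V uV; have := me1 V uV; rewrite /= -/r2; lra.
- by move=> W W0; have := mg1 W W0; rewrite /= -/r2; lra.
Qed.

End RateSplitting.

(** * Message components *)

Section Components.
Variables (R : realType) (k : cell -> nat) (C : mac_ic_mac R k).

(* [inl i] is the common part of the message of user i.1, [inr (i, 1)] its
   private part, and [inr (i, j)] with j <> 1 the message of user i.j. *)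
Definition component : finType := (cell + {i : cell & user k i})%type.

(** Superposition: the strategy of i.1 is drawn anew for each pair of a common and a private part,
    so that a wrong common part alone makes it fresh. The time-sharing seed is the same for all
    messages. *)
Definition slot_deps (l : slot k) : {set component} :=
  match l with
  | inl _ => finset.set0
  | inr (inl i) => [set inl i]%SET
  | inr (inr d) => inr d |: (if tagged d == user1 k (tag d) then [set inl (tag d)]%SET else finset.set0)
  end.

Definition relevant (i : cell) : {set component} :=
  [set d : component | if d is inr d' then tag d' == i else true].

Definition own (i : cell) : {set component} :=
  [set d : component | match d with inl i0 => i0 == i | inr d' => tag d' == i end].

(** A wrong common part of the other cell alone is no error for receiver [i]. *)
Definition bad (i : cell) : pred {set component} :=
  fun E => (E \subset relevant i) && ~~ [disjoint E & own i].

Definition comp_rate (r : rates R k) (s : cell -> R) (d : component) : R :=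
  match d with
  | inl i => rate r (user1 k i) - s i
  | inr d' => if tagged d' == user1 k (tag d') then s (tag d') else rate r (tagged d')
  end.

Definition own_users i (E : {set component}) : {set user k i} :=
  [set j | inr (Tagged (user k) j) \in E]%SET.

Lemma comp_rate_sum r s i (E : {set component}) : E \subset relevant i ->
  \sum_(d in E) comp_rate r s d =
  (if inl i \in E then rate r (user1 k i) - s i else 0) +
  (if inl (~~ i) \in E then rate r (user1 k (~~ i)) - s (~~ i) else 0) +
  (if user1 k i \in own_users i E then s i else 0) +
  sum_rate r (own_users i E :\ user1 k i).
Proof.
move=> /fintype.subsetP Ei; rewrite big_sumType /= -addrA; congr (_ + _).
  by rewrite big_mkcond big_bool /=; case: i Ei => _ //; rewrite addrC.
transitivity (\sum_(i0 : cell) \sum_(j : user k i0 | inr (Tagged (user k) j) \in E)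
    comp_rate r s (inr (Tagged (user k) j))).
  rewrite sig_big_dep /=; apply: eq_big => -[i0 j] //.
rewrite (bigD1 i) //= [X in _ + X]big1 ?addr0; last first.
  move=> i0 i0i; apply: big_pred0 => j; apply: contraNF i0i => /Ei.
  by rewrite inE.
rewrite (eq_bigl (mem (own_users i E))); last by move=> j; rewrite !inE.
case: ifP => uE.
  rewrite (big_setD1 (user1 k i)) //= ?eqxx; congr (_ + _).
  by apply: eq_bigr => j; rewrite !inE => /andP[/negbTE -> _].
rewrite add0r /sum_rate; apply: eq_big => j; rewrite !inE.
  by have [->|//] := eqVneq j (user1 k i); rewrite inE in uE; rewrite uE.
have [-> uE'|//] := eqVneq j (user1 k i).
by rewrite inE uE' in uE.
Qed.

Variables (Q : finType) (U : cell -> finType).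
Variables (pQ : Q -> R) (pU : forall i, Q -> U i -> R).
Variable (pX : forall i (j : user k i), Q * option (U i) -> ch_in C j -> R).
Hypothesis pQD : is_dist pQ.
Hypothesis pUD : forall i q, is_dist (@pU i q).
Hypothesis pXD : forall i (j : user k i) a, is_dist (@pX i j a).

Notation sl := (seed_law pQ pU pX).
Notation J := (refresh_info pQ pU pX).

Definition noise (i : cell) : {set slot k} :=
  refresh (finset.set0 : {set user k i}) false false.

Definition comp_info (i : cell) (E : {set component}) : R :=
  info sl (output_law (@seed_channel R k C Q U) (fun y : outputs C => y i))
    (noise i) (touched slot_deps E :|: noise i) / ln 2.

(** An error in the common part of i.1 also redraws the strategy of i.1, so that this user may be
    counted in [W] even when its private part is right. The claim is then an inclusion of sets of
    redrawn slots. *)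
Lemma refresh_info_le_comp_info i (E : {set component}) (W : {set user k i}) :
  W \subset own_users i E :|: (if inl i \in E then [set user1 k i]%SET else finset.set0) ->
  J W (inl i \in E) (inl (~~ i) \in E) <= comp_info i E.
Proof.
move=> /fintype.subsetP WE.
apply: ler_wpM2r; first by rewrite invr_ge0 ln_ge0 // ler1n.
apply: (info_mono (seed_law_dist pQD pUD pXD)).
  by move=> z; apply: output_law_dist; exact: seed_channel_dist.
have touchedP (l : slot k) d : d \in slot_deps l -> d \in E -> l \in touched slot_deps E.
  by move=> dl dE; rewrite inE; apply/pred0Pn; exists d; rewrite /= dl.
apply/fintype.subsetP => l; rewrite finset.in_setU; case: l => [[]|[i0|d]].
- by rewrite inE.
- rewrite inE => h; apply/orP; left; apply: (touchedP _ (inl i0)); first by rewrite /= inE.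
  by move: h; case: ifP => [/eqP->//|]; case: i0 i {WE touchedP W} => -[].
move=> h; have := h; rewrite inE; case: ifP => di; last by rewrite [in X in _ || X]inE di orbT.
move=> /imsetP[j jW ->]; apply/orP; left.
have := WE _ jW; rewrite finset.in_setU => /orP[jE|].
  apply: (touchedP (slotX j) (inr (Tagged (user k) j))); first by rewrite !inE eqxx.
  by rewrite inE in jE.
case: ifP => [iE|_]; last by rewrite finset.in_set0.
move=> /set1P ->; apply: (touchedP _ (inl i)) => //.
by rewrite !inE /= ?eqxx ?inE ?eqxx ?orbT.
Qed.

(** If the common part of i.1 is wrong, the parts of i.1 in [E] count for at most its whole rate,
    and the conditions on B and G apply to a set with i.1. If of i.1 only the private part is wrong,
    those on A and E apply; if neither, those on B and G at a set without i.1. *)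
Lemma comp_rate_le (r : rates R k) (s : cell -> R) i (E : {set component}) :
  nonneg_rates r -> (forall i, 0 <= s i <= rate r (user1 k i)) ->
  (forall V : {set user k i}, user1 k i \in V ->
    s i + sum_rate r (V :\ user1 k i) <= J V false false) ->
  (forall V : {set user k i}, user1 k i \in V ->
    s i + sum_rate r (V :\ user1 k i) + (rate r (user1 k (~~ i)) - s (~~ i)) <= J V false true) ->
  (forall W : {set user k i}, W != finset.set0 ->
    sum_rate r W <= J W (user1 k i \in W) false) ->
  (forall W : {set user k i}, W != finset.set0 ->
    sum_rate r W + (rate r (user1 k (~~ i)) - s (~~ i)) <= J W (user1 k i \in W) true) ->
  bad i E -> \sum_(d in E) comp_rate r s d <= comp_info i E.
Proof.
move=> r0 sr HA HE HB HG /andP[Ei Eown]; rewrite (@comp_rate_sum _ _ i) //.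
set W0 := own_users i E; have /andP[si0 sir] := sr i.
have := @refresh_info_le_comp_info i E; rewrite -/W0.
have [iE|iE] := boolP (inl i \in E).
  set W := W0 :|: [set user1 k i]%SET => /(_ W (fintype.subxx _)); apply: le_trans.
  have uW : user1 k i \in W by rewrite !inE eqxx orbT.
  have Wn : W != finset.set0 by apply/set0Pn; exists (user1 k i).
  have WD : sum_rate r W = rate r (user1 k i) + sum_rate r (W0 :\ user1 k i).
    rewrite (sum_rateD1 _ uW); congr (_ + sum_rate _ _); apply/setP => j.
    by rewrite !inE; case: eqP; rewrite ?orbF.
  have := HB W Wn; have := HG W Wn; rewrite uW WD.
  by case: ifP => _; case: ifP => _; lra.
rewrite finset.setU0 => /(_ W0 (fintype.subxx _)); apply: le_trans.
have [uW|uW] := boolP (user1 k i \in W0).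
  have := HA W0 uW; have := HE W0 uW.
  by case: ifP => _; lra.
have W0D : (W0 :\ user1 k i)%SET = W0.
  by apply/setP => j; rewrite !inE; case: eqP => // ->; rewrite inE in uW; rewrite (negbTE uW).
(* [bad] supplies an own component, which here is not the common part. *)
have Wn : W0 != finset.set0.
  move: Eown => /pred0Pn[[i0|[i0 j]]] /= /andP[dE]; rewrite inE => /eqP ii.
    by move: dE iE; rewrite ii => ->.
  rewrite /= in ii; subst i0; apply/set0Pn; exists j; by rewrite inE.
have := HB W0 Wn; have := HG W0 Wn; rewrite (negbTE uW) W0D.
by case: ifP => _; lra.
Qed.

End Components.

(** * Codes from codebooks *)

Section Code.
Variables (R : realType) (k : cell -> nat) (C : mac_ic_mac R k).
Variables (Q : finType) (U : cell -> finType).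
Variables (pQ : Q -> R) (pU : forall i, Q -> U i -> R).
Variable (pX : forall i (j : user k i), Q * option (U i) -> ch_in C j -> R).
Hypothesis pQD : is_dist pQ.
Hypothesis pUD : forall i q, is_dist (@pU i q).
Hypothesis pXD : forall i (j : user k i) a, is_dist (@pX i j a).

Notation sl := (seed_law pQ pU pX).
Notation V := (@seed_channel R k C Q U).
Notation out i := (output_law V (fun y : outputs C => y i)).
Notation dep := (@slot_deps k).
Notation noise := (@noise k).

Definition metric (i : cell) (z : {dffun forall l, seed C Q U l}) (y : outputs C) : R :=
  smear sl (out i) (noise i) z (y i).

Variables (n : nat) (M : forall i, user k i -> nat) (sz : component k -> nat).
Hypothesis M0 : forall i (j : user k i), (0 < M j)%N.
Hypothesis Msz : forall i (j : user k i), j != user1 k i ->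
  (M j <= (sz (inr (Tagged (user k) j))).+1)%N.
Hypothesis Msz1 : forall i,
  (M (user1 k i) <= (sz (inl i)).+1 * (sz (inr (Tagged (user k) (user1 k i)))).+1)%N.

Notation book := {ffun 'I_n -> codebook (seed C Q U) sz}.
Notation msg := (messages_of sz).

(** Division by the number of private messages: the quotient is the common part of the message of
    i.1, the remainder its private part. By [Msz] and [Msz1], [inord] is never out of range. *)
Definition split_message (m : messages M) : msg :=
  [ffun d : component k =>
    match d return 'I_(sz d).+1 with
    | inl i => inord (m i (user1 k i) %/ (sz (inr (Tagged (user k) (user1 k i)))).+1)
    | inr d => inord (if tagged d == user1 k (tag d)
                      then m (tag d) (tagged d) %% (sz (inr d)).+1 else m (tag d) (tagged d))%N
    end].

Lemma split_message_inj i (m m' : messages M) :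
  (forall d, d \in own k i -> split_message m d = split_message m' d) -> m i = m' i.
Proof.
move=> mm'; apply/ffunP => j; apply: val_inj => /=.
have := mm' (inr (Tagged (user k) j)); rewrite !ffunE /= inE /= => /(_ (eqxx _)) /(congr1 (@nat_of_ord _)).
have [->|ju] := eqVneq j (user1 k i).
  rewrite !inordK ?ltn_pmod // => modE.
  have := mm' (inl i); rewrite !ffunE /= inE => /(_ (eqxx _)) /(congr1 (@nat_of_ord _)).
  have lt_div (x : 'I_(M (user1 k i))) :
    (x %/ (sz (inr (Tagged (user k) (user1 k i)))).+1 < (sz (inl i)).+1)%N.
    by rewrite ltn_divLR //; apply: leq_trans (ltn_ord x) (Msz1 i).
  rewrite !inordK ?lt_div // => divE.
  by rewrite (divn_eq (m i (user1 k i)) (sz (inr (Tagged (user k) (user1 k i)))).+1) divE modE -divn_eq.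
have lt_m (x : 'I_(M j)) : (x < (sz (inr (Tagged (user k) j))).+1)%N.
  by apply: leq_trans (ltn_ord x) (Msz ju).
by rewrite !inordK ?lt_m.
Qed.

Lemma split_message_dep i (j : user k i) (m m' : messages M) : m i j = m' i j ->
  forall d, d \in dep (slotX j) -> split_message m d = split_message m' d.
Proof.
move=> mm' d; rewrite !inE /= => /orP[/eqP ->|].
  by rewrite !ffunE /= mm'.
case: ifP => // /eqP ju; last by rewrite inE.
by rewrite inE => /eqP ->; rewrite !ffunE -ju mm'.
Qed.

Definition message0 : messages M :=
  [ffun i => [ffun j => Ordinal (M0 j)] : cell_message M i].

Variable w : book.

Definition sent (v : msg) (t : 'I_n) := letters dep w v t.

(** A user knows just its own message while [split_message] wants a full tuple. Any completion of
    [a] serves, since the symbols sent depend on the own message alone. *)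
Definition encoder i (j : user k i) (a : 'I_(M j)) : {ffun 'I_n -> ch_in C j} :=
  let m := odflt message0 [pick m : messages M | m i j == a] in
  [ffun t => zX j (sent (split_message m) t)].

Definition ml_decode (i : cell) (y : {ffun 'I_n -> ch_out C i}) : msg :=
  [arg max_(v > split_message message0)
    \prod_t smear sl (out i) (noise i) (sent v t) (y t)]%O.

(** The own components of the maximizer need not come from any message, as the component alphabets
    may be larger than needed; [message0] is then the default. *)
Definition decoder (i : cell) (y : {ffun 'I_n -> ch_out C i}) : cell_message M i :=
  let v := ml_decode y in
  odflt message0 [pick m : messages M | [forall d in own k i, split_message m d == v d]] i.

Definition book_code : Defs.code C n M := Defs.Code encoder decoder.

Lemma codeword_index_agree (l : slot k) (v v' : msg) :
  (forall d, d \in dep l -> v d = v' d) -> codeword_index dep l v = codeword_index dep l v'.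
Proof. by move=> vv'; apply/ffunP => d; rewrite !ffunE; case: ifP => // /vv'. Qed.

Lemma sent_agree (l : slot k) (v v' : msg) t :
  (forall d, d \in dep l -> v d = v' d) -> sent v t l = sent v' t l.
Proof. by move=> vv'; rewrite !ffunE (codeword_index_agree vv'). Qed.

Lemma encoderE (m : messages M) i (j : user k i) t :
  encoder (m i j) t = zX j (sent (split_message m) t).
Proof.
rewrite ffunE; case: pickP => [m' /= /eqP mm'|/(_ m)]; last by rewrite eqxx.
have dj := split_message_dep mm'.
have zq : zQ (sent (split_message m') t) = zQ (sent (split_message m) t).
  by rewrite /zQ (@sent_agree (inl tt) _ (split_message m)) // => d; rewrite inE.
rewrite /zX zq (sent_agree t dj); congr (_ _).
rewrite /strategy_arg; case: eqP => // ju; congr (_, Some _).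
rewrite /zU zq (@sent_agree (inr (inl i)) _ (split_message m)) // => d.
by rewrite inE => /eqP ->; apply: dj; rewrite !inE /= ju ?eqxx inE eqxx.
Qed.

Lemma codewordE (m : messages M) t :
  codeword book_code m t = (letter (sent (split_message m) t)).2.
Proof.
apply/ffunP => i; rewrite [LHS]ffunE [RHS]ffunE; apply/ffunP => j; rewrite [LHS]ffunE [RHS]ffunE.
exact: encoderE.
Qed.

(** A slot outside the noise depends on relevant components only, and the noise is averaged out. *)
Lemma metric_agree i (v v' : msg) t b :
  (forall d, d \in relevant k i -> v d = v' d) ->
  smear sl (out i) (noise i) (sent v t) b = smear sl (out i) (noise i) (sent v' t) b.
Proof.
move=> vv'; rewrite /smear.
rewrite -[LHS](@resample_untouched _ _ _ sl (noise i) _ (sent v' t) (sent v t)).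
congr (resample _ _ _ _); apply/ffunP => l; rewrite !ffunE.
case: ifP => // lN; congr (w t l _); apply: codeword_index_agree => d dl; apply: vv'.
move: lN dl; rewrite !inE; case: l => [[]|[i0|d']]; rewrite /= ?inE //.
  by move=> _ /eqP ->.
case: ifP => // di _ /orP[/eqP ->//|]; by case: ifP; rewrite inE // => _ /eqP->.
Qed.

Lemma decoder_ml_error (m : messages M) i (y : {ffun 'I_n -> outputs C}) :
  decoder [ffun t => y t i] != m i ->
  ml_error dep (metric i) (bad i) w (split_message m) y.
Proof.
rewrite /decoder; set v := ml_decode _.
have vmax (v' : msg) : \prod_t metric i (sent v' t) (y t) <= \prod_t metric i (sent v t) (y t).
  have mE v0 : \prod_t metric i (sent v0 t) (y t) =
      \prod_t smear sl (out i) (noise i) (sent v0 t) ([ffun t => y t i] t).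
    by apply: eq_bigr => t _; rewrite ffunE.
  rewrite !mE /v /ml_decode; case: (@arg_maxP _ _ _ (split_message message0) xpredT (fun v1 : msg => \prod_t smear sl (out i) (noise i) (sent v1 t) ([ffun t => y t i] t)) isT) => /= v0 _; exact.
move=> dec_neq.
have [d dO dm] : exists2 d, d \in own k i & split_message m d != v d.
  apply/exists_inP; apply: contraNT dec_neq; rewrite negb_exists_in => /forall_inP agree.
  apply/eqP; case: pickP => [m' /= /forall_inP m'v|/(_ m)] /=.
    apply: split_message_inj => d dO; rewrite (eqP (m'v d dO)).
    by have := agree d dO; rewrite negbK => /eqP.
  by move/negP; case; apply/forall_inP => d /agree; rewrite negbK.
(* The maximizer with its irrelevant components corrected: its likelihood is unchanged, and it
   differs from the sent message on relevant components only. *)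
pose v' : msg := [ffun d => if d \in relevant k i then v d else split_message m d].
have v'E d' : v' d' = if d' \in relevant k i then v d' else split_message m d'.
  by rewrite ffunE.
have own_rel : d \in relevant k i.
  by move: dO; rewrite !inE; case: (d).
apply/existsP; exists v'; apply/andP; split.
  apply/andP; split.
    apply/fintype.subsetP => d'; rewrite inE v'E; case: ifP => // _.
    by rewrite eqxx.
  by apply/pred0Pn; exists d; rewrite /= dO andbT inE v'E own_rel.
apply: le_trans (vmax (split_message m)) _.
rewrite le_eqVlt; apply/orP; left; apply/eqP; apply: eq_bigr => t _.
by apply: metric_agree => d' d'r; rewrite v'E d'r.
Qed.

Lemma error_prob_le :
  error_prob book_code <=
  #|messages M|%:R^-1 * \sum_(m : messages M) \sum_(i : cell)
    \sum_(y : {ffun 'I_n -> outputs C})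
      (\prod_t V (letters dep w (split_message m) t) (y t)) *
      (ml_error dep (metric i) (bad i) w (split_message m) y)%:R.
Proof.
rewrite /error_prob; apply: ler_wpM2l; first by rewrite invr_ge0.
apply: ler_sum => m _; rewrite exchange_big /= big_mkcond /=; apply: ler_sum => y _.
have c0 : 0 <= \prod_t V (letters dep w (split_message m) t) (y t).
  by apply: prodr_ge0 => t _; case: (seed_channel_dist (letters dep w (split_message m) t)).
case: ifP => [/existsP[i err]|_]; last by apply: sumr_ge0 => i _; apply: mulr_ge0.
rewrite (bigD1 i) //= decoder_ml_error // mulr1.
under eq_bigr do rewrite codewordE.
by rewrite lerDl; apply: sumr_ge0 => i' _; apply: mulr_ge0.
Qed.

End Code.

(** * Achievability *)

Section Achievability.
Variables (R : realType) (k : cell -> nat) (C : mac_ic_mac R k).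
Variables (Q : finType) (U : cell -> finType).
Variables (pQ : Q -> R) (pU : forall i, Q -> U i -> R).
Variable (pX : forall i (j : user k i), Q * option (U i) -> ch_in C j -> R).
Hypothesis pQD : is_dist pQ.
Hypothesis pUD : forall i q, is_dist (@pU i q).
Hypothesis pXD : forall i (j : user k i) a, is_dist (@pX i j a).

Notation sl := (seed_law pQ pU pX).
Notation V := (@seed_channel R k C Q U).
Notation out i := (output_law V (fun y : outputs C => y i)).
Notation dep := (@slot_deps k).
Notation noise := (@noise k).
Notation metric i := (@metric R k C Q U pQ pU pX i).
Notation iota i E := (comp_info pQ pU pX i E).

Let slD := seed_law_dist pQD pUD pXD.
Let VD z : is_dist (V z) := seed_channel_dist z.
Let outD i z : is_dist (out i z) := output_law_dist VD (fun y : outputs C => y i) z.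

Lemma metric_ge0 i z y : 0 <= metric i z y.
Proof. by apply: (smear_ge0 slD (outD i)). Qed.

Lemma out_gt0 i z y : 0 < V z y -> 0 < out i z (y i).
Proof.
move=> Vy; rewrite /output_law (bigD1 y) //= ltr_pwDl //.
by apply: sumr_ge0 => y' _; case: (VD z).
Qed.

Lemma metric_gt0 i z y : 0 < indep_law sl z -> 0 < V z y -> 0 < metric i z y.
Proof. by move=> pz Vy; apply: (smear_gt0 slD (outD i)) => //; exact: out_gt0. Qed.

Lemma ratioE i E z y : ratio sl dep (metric i) E z y =
  smear sl (out i) (touched dep E :|: noise i) z (y i) / smear sl (out i) (noise i) z (y i).
Proof. by rewrite /smear -(resample_resample slD). Qed.

Definition tilted i E (sg : R) : R :=
  \sum_z \sum_y indep_law sl z * V z y * ratio sl dep (metric i) E z y `^ sg.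

Lemma tilted_ge0 i E sg : 0 <= tilted i E sg.
Proof.
apply: sumr_ge0 => z _; apply: sumr_ge0 => y _; apply: mulr_ge0; last exact: powR_ge0.
by apply: mulr_ge0; [case: (indep_law_dist slD)|case: (VD z)].
Qed.

Lemma exists_exponent i E (rho : R) : rho < iota i E ->
  exists2 sg, 0 < sg <= 1 & expR (sg * (rho * ln 2)) * tilted i E sg < 1.
Proof.
move=> rhoI.
have ln2 : 0 < ln 2 :> R by rewrite ln_gt0 // ltr1n.
pose q (zy : {dffun forall l, seed C Q U l} * outputs C) := indep_law sl zy.1 * V zy.1 zy.2.
have qD : is_dist q.
  split=> [zy|].
    by apply: mulr_ge0; [case: (indep_law_dist slD)|case: (VD zy.1)].
  rewrite -(pair_bigA _ (fun z y => indep_law sl z * V z y)) /=.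
  under eq_bigr => z _ do rewrite -mulr_sumr (proj2 (VD z)) mulr1.
  by case: (indep_law_dist slD).
have qpos zy : 0 < q zy -> 0 < indep_law sl zy.1 /\ 0 < V zy.1 zy.2.
  exact: (weight_gt0 slD VD).
have [||sg sg01 lt1] := @exists_tilt _ _ q
    (fun zy => ratio sl dep (metric i) E zy.1 zy.2) (rho * ln 2) qD.
- move=> zy /qpos[pz Vy]; rewrite ratioE divr_gt0 //.
    by apply: (smear_gt0 slD (outD i)) => //; exact: out_gt0.
  by apply: (smear_gt0 slD (outD i)) => //; exact: out_gt0.
(* The mean of minus the logarithm of [ratio] is [comp_info] in nats; [output_law_sum] passes from
   the pair of outputs to that of receiver [i]. *)
- move: rhoI; rewrite /comp_info ltr_pdivlMr // => /lt_le_trans; apply.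
  rewrite -(pair_bigA _ (fun z y => indep_law sl z * V z y *
    ln (ratio sl dep (metric i) E z y))) /=.
  rewrite -sumrN; apply: ler_sum => z _; rewrite -sumrN.
  under eq_bigr do rewrite -mulrA.
  rewrite -mulr_sumr (output_law_sum V (fun y : outputs C => y i) z (fun b => ln _)).
  rewrite mulr_sumr; apply: ler_sum => y _; rewrite mulrA -mulrN.
  have [pV|->] := weight_eq0 slD VD z y; last by rewrite !mul0r.
  have [pz Vy] := weight_gt0 slD VD pV.
  rewrite ratioE -[X in _ <= _ * - ln X]invf_div lnV ?opprK // posrE divr_gt0 //.
    by apply: (smear_gt0 slD (outD i)) => //; exact: out_gt0.
  by apply: (smear_gt0 slD (outD i)) => //; exact: out_gt0.
exists sg => //; move: lt1; rewrite -(pair_bigA _ (fun z y => indep_law sl z * V z y *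
    ratio sl dep (metric i) E z y `^ sg)) /=.
exact.
Qed.

(* One less than the number of messages, since messages range over ['I_(s d).+1]:
   it counts the competitors and vanishes at rate 0. *)
Definition comp_size (rho : component k -> R) (n : nat) (d : component k) : nat :=
  `|Num.ceil (2 `^ (n%:R * rho d) : R)|%N.-1.

Lemma ceil_pred (x : R) : 0 < x ->
  (`|Num.ceil x|%N.-1.+1 = `|Num.ceil x|%N) /\ (`|Num.ceil x|%N.-1)%:R <= x :> R.
Proof.
move=> x0.
have [m cE] : exists m : nat, Num.ceil x = m.+1.
  have c0 : 0 < Num.ceil x by rewrite ceil_gt0.
  by exists `|Num.ceil x|%N.-1; rewrite prednK ?absz_gt0 ?gt_eqF // gtz0_abs.
rewrite cE absz_nat; split=> //=.
by have := ceilB1_lt x; rewrite cE intS addrAC subrr add0r => /ltW.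
Qed.

(** Rounding up separately leaves room for all messages of i.1 among the pairs of a common and a
    private part. *)
Lemma ceil_mul_le (x y : R) : 0 < x -> 0 < y ->
  (`|Num.ceil (x * y)| <= `|Num.ceil x| * `|Num.ceil y|)%N.
Proof.
move=> x0 y0; rewrite -lez_nat PoszM !gtz0_abs ?ceil_gt0 ?mulr_gt0 //.
by rewrite ceil_le_int intrM ler_pM ?ceil_ge // ltW.
Qed.

Lemma comp_sizeS rho n d :
  (comp_size rho n d).+1 = `|Num.ceil (2 `^ (n%:R * rho d) : R)|%N.
Proof. by apply: (proj1 (ceil_pred _)); exact: powR_gt0. Qed.

Lemma comp_size_le rho n (E : {set component k}) :
  (\prod_(d in E) comp_size rho n d)%N%:R <= expR ((\sum_(d in E) rho d) * ln 2) ^+ n :> R.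
Proof.
rewrite natr_prod -expRM_natl mulrA mulr_sumr mulr_suml expR_sum.
apply: ler_prod => d _; rewrite ler0n /=.
apply: (le_trans (proj2 (ceil_pred _))); first exact: powR_gt0.
by rewrite /powR pnatr_eq0.
Qed.

(** Nonnegative rates with sum at most 0 all vanish, and a component of rate 0 has a single message,
    hence no competitor. *)
Lemma comp_size_eq0 rho n (E : {set component k}) : (forall d, 0 <= rho d) ->
  E != finset.set0 -> \sum_(d in E) rho d <= 0 ->
  (\prod_(d in E) comp_size rho n d = 0)%N.
Proof.
move=> rho0 /set0Pn[d dE] rE0.
have rd : rho d = 0.
  apply/eqP; rewrite eq_le rho0 andbT; apply: le_trans rE0.
  by rewrite (bigD1 d) //= lerDl; apply: sumr_ge0.
by rewrite (bigD1 d) //= /comp_size rd mulr0 powRr0 ceil1.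
Qed.

Lemma exists_le_mean (T : finType) (q f : T -> R) b :
  is_dist q -> \sum_t q t * f t <= b -> exists t, f t <= b.
Proof.
move=> [q0 q1] fb; apply: contrapT => /forallNP nf.
have bf t : 0 <= f t - b by rewrite subr_ge0 leNgt; apply/negP => /ltW /nf.
have s0 : \sum_t q t * (f t - b) = 0.
  apply/eqP; rewrite eq_le sumr_ge0 ?andbT => [|t _]; last exact: mulr_ge0.
  by under eq_bigr do rewrite mulrBr; rewrite sumrB -mulr_suml q1 mul1r subr_le0.
have := oner_neq0 R; rewrite -q1 big1 ?eqxx // => t _.
have /eqP := psumr_eq0P (fun t _ => mulr_ge0 (q0 t) (bf t)) s0 (i := t) isT.
rewrite mulf_eq0 => /orP[/eqP//|]; rewrite subr_eq0 => /eqP ft.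
by case: (nf t); rewrite ft.
Qed.

Lemma exists_code n (M : forall i, user k i -> nat) (sz : component k -> nat)
    (sg : cell -> {set component k} -> R) :
  (forall i (j : user k i), (0 < M i j)%N) ->
  (forall i (j : user k i), j != user1 k i -> (M i j <= (sz (inr (Tagged (user k) j))).+1)%N) ->
  (forall i, (M i (user1 k i) <=
     (sz (inl i)).+1 * (sz (inr (Tagged (user k) (user1 k i)))).+1)%N) ->
  (forall i E, 0 < sg i E <= 1) ->
  exists c : Defs.code C n M, error_prob c <= \sum_(i : cell) \sum_(E | bad i E)
    (\prod_(d in E) sz d)%N%:R `^ sg i E * tilted i E (sg i E) ^+ n.
Proof.
move=> M0 Msz Msz1 sg01.
suff [w wP] : exists w : {ffun 'I_n -> codebook (seed C Q U) sz},
    error_prob (book_code pQ pU pX M0 w) <= \sum_(i : cell) \sum_(E | bad i E)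
    (\prod_(d in E) sz d)%N%:R `^ sg i E * tilted i E (sg i E) ^+ n.
  by exists (book_code pQ pU pX M0 w).
apply: (exists_le_mean (book_law_dist slD sz n)).
apply: (@le_trans _ _ (\sum_w book_law sl w * (#|messages M|%:R^-1 *
  \sum_(m : messages M) \sum_(i : cell) \sum_(y : {ffun 'I_n -> outputs C})
   (\prod_t V (letters dep w (split_message sz m) t) (y t)) *
      (ml_error dep (metric i) (bad i) w (split_message sz m) y)%:R))).
  apply: ler_sum => w _; apply: ler_wpM2l; first by case: (book_law_dist slD sz n).
  exact: error_prob_le.
have M1 : 0 < #|messages M|%:R :> R.
  by rewrite ltr0n; apply/card_gt0P; exists (message0 M0).
(* Averages over codebooks and messages are exchanged; [random_coding] then bounds each message
   separately. *)
under eq_bigr do rewrite mulrCA.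
rewrite -mulr_sumr ler_pdivrMl // mulr_natl -sumr_const.
under eq_bigr do rewrite mulr_sumr.
rewrite exchange_big /=; apply: ler_sum => m _.
under eq_bigr do rewrite mulr_sumr.
rewrite exchange_big /=; apply: ler_sum => i _.
exact: (random_coding slD dep VD (@metric_ge0 i) (@metric_gt0 i) n (bad i) _ (sg01 i)).
Qed.

Lemma error_prob_ge0 n (M : forall i, user k i -> nat) (c : Defs.code C n M) :
  0 <= error_prob c.
Proof.
apply: mulr_ge0; first by rewrite invr_ge0.
apply: sumr_ge0 => m _; apply: sumr_ge0 => y _; apply: prodr_ge0 => t _.
by case: (channel_law_dist (codeword c m t)).
Qed.

Lemma exists_decay (rho : component k -> R) i E : (forall d, 0 <= rho d) ->
  (bad i E -> 0 < \sum_(d in E) rho d -> \sum_(d in E) rho d < iota i E) ->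
  exists sgb : R * R, [/\ 0 < sgb.1 <= 1, 0 <= sgb.2 < 1 & bad i E -> forall n,
    (\prod_(d in E) comp_size rho n d)%N%:R `^ sgb.1 * tilted i E sgb.1 ^+ n <= sgb.2 ^+ n].
Proof.
move=> rho0 rI.
(* For sets that are not bad the pair is arbitrary; it is supplied so that one choice covers all
   [E]. *)
have [Ebad|Ebad] := boolP (bad i E); last by exists (1, 0); split; rewrite //= ?ltr01 ?lexx.
have [rE0|rE] := leP (\sum_(d in E) rho d) 0.
  exists (1, 0); split; rewrite /= ?ltr01 ?lexx // => _ n.
  rewrite comp_size_eq0 //; last first.
    by case/andP: Ebad => _; apply: contraNneq => ->; rewrite -finset.setI_eq0 finset.set0I.
  by rewrite powR0 ?oner_neq0 // mul0r exprn_ge0.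
have [sg sg01 lt1] := exists_exponent (rI Ebad rE).
exists (sg, expR (sg * ((\sum_(d in E) rho d) * ln 2)) * tilted i E sg); split=> //=.
  by rewrite lt1 mulr_ge0 ?expR_ge0 ?tilted_ge0.
move=> _ n; rewrite exprMn ler_wpM2r ?exprn_ge0 ?tilted_ge0 //.
rewrite mulrC expRM.
rewrite -powR_mulrn ?powR_ge0 // powRAC powR_mulrn ?expR_ge0 //.
apply: ge0_ler_powR; rewrite ?nnegrE ?exprn_ge0 ?expR_ge0 //; last exact: comp_size_le.
by case/andP: sg01 => /ltW.
Qed.

Lemma achievable_of_split (r : rates R k) (s : cell -> R) :
  nonneg_rates r -> (forall i, 0 <= s i <= rate r (user1 k i)) ->
  (forall i E, bad i E -> 0 < \sum_(d in E) comp_rate r s d ->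
    \sum_(d in E) comp_rate r s d < iota i E) ->
  achievable C r.
Proof.
move=> r0 sr rI; split=> //.
set rho := comp_rate r s.
have rho0 d : 0 <= rho d.
  case: d => [i|[i j]] /=; first by case/andP: (sr i) => _; rewrite subr_ge0.
  by case: ifP => _; [case/andP: (sr i)|exact: r0].
pose sgb i E := sval (cid (exists_decay (E := E) rho0 (rI i E))).
have sgbP i E := svalP (cid (exists_decay (E := E) rho0 (rI i E))).
have codes n : exists c : Defs.code C n (num_messages r n),
    error_prob c <= \sum_(i : cell) \sum_(E | bad i E) (sgb i E).2 ^+ n.
  have [| | | |c cP] := @exists_code n (num_messages r n) (comp_size rho n)
      (fun i E => (sgb i E).1).
  - by move=> i j; rewrite /num_messages absz_gt0 gt_eqF // ceil_gt0 powR_gt0.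
  - by move=> i j /negbTE ju; rewrite comp_sizeS /num_messages /rho /= ju.
  - move=> i; rewrite !comp_sizeS /num_messages /rho /=.
    apply: leq_trans (ceil_mul_le _ _); rewrite ?powR_gt0 // ?eqxx.
    by rewrite -powRD ?pnatr_eq0 ?implybT // -mulrDr subrK.
  - by move=> i E; case: (sgbP i E).
  exists c; apply: le_trans cP _; apply: ler_sum => i _; apply: ler_sum => E Ebad.
  by case: (sgbP i E) => _ _; apply.
exists (fun n => sval (cid (codes n))).
apply: (@squeeze_cvgr _ _ _ _ (cst 0) (fun n => \sum_(i : cell) \sum_(E | bad i E) (sgb i E).2 ^+ n)).
- near=> n; rewrite error_prob_ge0 /=; exact: (svalP (cid (codes n))).
- exact: cvg_cst.
have S0 : \sum_(i : cell) \sum_(E | @bad k i E) 0 = 0 :> R.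
  by rewrite big1 // => i _; rewrite big1.
rewrite -[X in (_ --> X)%classic]S0.
apply: cvg_big => [|i _]; first exact: add_continuous.
apply: cvg_big => [|E _]; first exact: add_continuous.
apply: cvg_expr; case: (sgbP i E) => _ /andP[b0 b1] _.
by rewrite ger0_norm.
Unshelve. all: by end_near. Qed.

End Achievability.

(** * Scaled rates and passage to the closure *)

Definition scale_rates (R : realType) (k : cell -> nat) (a : R) (r : rates R k) : rates R k :=
  (a *: r.1, a *: r.2).

Lemma rate_scale (R : realType) (k : cell -> nat) (a : R) (r : rates R k) i (j : user k i) :
  rate (scale_rates a r) j = a * rate r j.
Proof. by case: i j => j; rewrite /= mxE. Qed.

Lemma cvg_scale_rates (R : realType) (k : cell -> nat) (r : rates R k) :
  ((fun e : R => scale_rates (1 - e) r) @ 0^'+ --> r)%classic.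
Proof.
have e1 : ((fun e : R => 1 - e) @ 0^'+ --> (1 : R))%classic.
  rewrite -[X in (_ --> X)%classic]subr0; apply: cvgB; first exact: cvg_cst.
  exact: cvg_at_right_filter.
have cvgZ1 n (v : 'rV[R]_n.+1) : ((fun e : R => (1 - e) *: v) @ 0^'+ --> v)%classic.
  by have := @cvgZr_tmp _ 'rV[R]_n.+1 _ _ _ _ _ v e1; rewrite scale1r; apply.
by case: r => r1 r2; exact: (cvg_pair (cvgZ1 _ r1) (cvgZ1 _ r2)).
Qed.

Local Open Scope classical_set_scope.

Theorem theorem1 (R : realType) (k : cell -> nat) (C : mac_ic_mac R k)
    (Q : finType) (U : cell -> finType) (P : coding C Q U -> R)
    (hP : coding_dist P) :
  inner_region P `<=` capacity_region C.
Proof.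
have [pQ [pU [pX [pQD pUD pXD PE]]]] := coding_kernels hP.
move=> r rP; have [r0 _] := rP.
have AJ i V := infoAE pQD pUD pXD PE (i := i) V.
have BJ i V := infoBE pQD pUD pXD PE (i := i) V.
have EJ i V := infoEE pQD pUD pXD PE (i := i) V.
have GJ i V := infoGE pQD pUD pXD PE (i := i) V.
have Jmono i := @refresh_info_mono _ _ _ _ _ pQ pU pX pQD pUD pXD i.
(* The five hypotheses of [rate_splitting] follow from the monotonicity of [refresh_info]. *)
have [i V|i V|i V|i V|i V|s sP] := @rate_splitting _ _ _ _ _ P _ _ _ _ _ r rP.
- by rewrite AJ -(refresh_info0 pQD pUD pXD i); apply: Jmono => //; exact: finset.sub0set.
- by rewrite AJ BJ finset.setD11; apply: Jmono => //; exact: subD1set.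
- by rewrite AJ EJ; apply: Jmono.
- by rewrite EJ GJ finset.setD11; apply: Jmono => //; exact: subD1set.
- by rewrite BJ GJ; apply: Jmono => //; rewrite implybb.
have s01 i : (0 <= s i <= rate r (user1 k i))%R by case: (sP i).
have rho_le i E : bad i E ->
    (\sum_(d in E) comp_rate r s d <= comp_info pQ pU pX i E)%R.
  have [_ sA sE sB sG] := sP i; apply: comp_rate_le => // [V uV|V uV|W W0|W W0].
  - by rewrite -AJ; exact: sA.
  - by rewrite -EJ; exact: sE.
  - by rewrite -BJ; exact: sB.
  - by rewrite -GJ; exact: sG.
(* Scaling the rates and the split by [1 - e] makes every constraint with a positive left side
   strict. *)
have ach e : (0 < e < 1)%R -> achievable C (scale_rates (1 - e) r).
  move=> /andP[e0 e1]; have f0 : (0 < 1 - e)%R by rewrite subr_gt0.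
  apply: (@achievable_of_split _ _ _ _ _ pQ pU pX pQD pUD pXD _ (fun i => (1 - e) * s i)%R).
  - by move=> i j; rewrite rate_scale mulr_ge0 ?(ltW f0).
  - move=> i; have /andP[si sir] := s01 i.
    by rewrite rate_scale mulr_ge0 ?(ltW f0) //= ler_pM2l.
  move=> i E Ebad.
  have -> : (\sum_(d in E) comp_rate (scale_rates (1 - e) r) (fun i => (1 - e) * s i) d =
      (1 - e) * \sum_(d in E) comp_rate r s d)%R.
    rewrite mulr_sumr; apply: eq_bigr => -[i0|[i0 j]] _ /=.
      by rewrite rate_scale mulrBr.
    by case: ifP => // _; rewrite rate_scale.
  rewrite pmulr_rgt0 // => rE; apply: lt_le_trans (rho_le i E Ebad).
  by rewrite gtr_pMl // ltrBlDr ltrDl.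
(* Every neighbourhood of [r] contains a scaled tuple with [0 < e < 1]. *)
move=> B /cvg_scale_rates Bnear0.
have Bnear : \forall e \near (0 : R)^'+, B (scale_rates (1 - e) r)  by exact: Bnear0.
have near01 : \forall e \near (0 : R)^'+, (0 < e < 1)%R.
  near=> e; apply/andP; split; near: e; first exact: nbhs_right_gt.
  by apply: nbhs_right_lt; exact: ltr01.
have [e [Be e01]] := filter_ex (filterI Bnear near01).
by exists (scale_rates (1 - e) r); split => //; exact: ach.
Unshelve. all: by end_near. Qed.
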